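(* Let $V$ be a finite binary relational vocabulary and let $T$ be an $\omega$-categorical simple $V$-theory with SU-rank $1$ and trivial pregeometry. Then there exist, for each $n\in\mathbb{N}$, a non-empty finite set $\mathbf{K}_n$ of finite $V$-structures and a probability measure $\mu_n$ on $\mathbf{K}_n$ such that, with $\mathbf{K}=(\mathbf{K}_n,\mu_n)_{n\in\mathbb{N}}$, the almost sure theory of $\mathbf{K}$ satisfies $T_{\mathbf{K}}=T$.
   Context: A vocabulary is binary if it contains only relation symbols of arity at most $2$. A theory is $\omega$-categorical if it has a unique countable model up to isomorphism (read as: it has no finite models and exactly one countably infinite model up to isomorphism). Theories are identified with their deductive closure. For a simple theory of SU-rank $1$ and a model $\mathcal{M}$, the pair $(M,\mathrm{acl})$ is a pregeometry; $T$ has trivial pregeometry if $\mathrm{acl}(X)=X\cup\mathrm{acl}(\emptyset)$ for all $\mathcal{M}\models T$ and $X\subseteq M$. Given $\mathbf{K}=(\mathbf{K}_n,\mu_n)_{n\in\mathbb{N}}$, a sentence $\varphi$ is almost sure in $\mathbf{K}$ if $\lim_{n\to\infty}\mu_n(\{\mathcal{N}\in\mathbf{K}_n:\mathcal{N}\models\varphi\})=1$. The almost sure theory $T_{\mathbf{K}}$ is the set of all almost sure sentences. *)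

(* Defs.v *)
From HB Require Import structures.
From mathcomp Require Import all_boot all_order all_algebra.
From mathcomp Require Import all_classical all_reals all_analysis.

Set Implicit Arguments.
Unset Strict Implicit.
Unset Printing Implicit Defensive.

Import numFieldNormedType.Exports.

Local Open Scope classical_set_scope.
Local Open Scope card_scope.
Local Open Scope ring_scope.

(** * First-order logic over a finite relational vocabulary *)

Record vocabulary := Vocabulary {
  symb : finType;
  arity : symb -> nat
}.

Definition binary (V : vocabulary) : Prop := forall r : symb V, (arity r <= 2)%N.

(* [formula V n]: formulas whose free variables are among 'I_n. [All] binds
   the variable of index 0 of its body. The other connectives are classically
   definable. *)
Inductive formula (V : vocabulary) (n : nat) : Type :=
| Fls
| Eqn of 'I_n & 'I_n
| Rel (r : symb V) of (arity r).-tuple 'I_n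
| Imp of formula V n & formula V n
| All of formula V n.+1.

Definition sentence (V : vocabulary) : Type := formula V 0.

Record structure (V : vocabulary) := Structure {
  carrier :> Type;
  interp : forall r : symb V, (arity r).-tuple carrier -> Prop;
  carrier_inhabited : inhabited carrier
}.

Fixpoint sat (V : vocabulary) (M : structure V) (n : nat) (phi : formula V n) :
    n.-tuple M -> Prop :=
  match phi with
  | Fls => fun _ => False
  | Eqn i j => fun v => tnth v i = tnth v j
  | Rel r t => fun v => interp (map_tuple (tnth v) t)
  | Imp phi1 phi2 => fun v => sat phi1 v -> sat phi2 v
  | All phi1 => fun v => forall x : M, sat phi1 [tuple of x :: v]
  end.

Definition holds (V : vocabulary) (M : structure V) (phi : sentence V) : Prop :=
  sat phi [tuple of [::] : seq M].

Definition model (V : vocabulary) (T : set (sentence V)) (M : structure V) :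
    Prop :=
  forall phi : sentence V, T phi -> holds M phi.

Definition deductive_closure (V : vocabulary) (T : set (sentence V)) :
    set (sentence V) :=
  [set phi | forall M : structure V, model T M -> holds M phi].

Definition isomorphic (V : vocabulary) (M N : structure V) : Prop :=
  exists f : M -> N, bijective f /\
    forall (r : symb V) (t : (arity r).-tuple M),
      interp t <-> interp (map_tuple f t).

Definition elementary (V : vocabulary) (M N : structure V) (f : M -> N) : Prop :=
  forall (n : nat) (phi : formula V n) (v : n.-tuple M),
    sat phi v <-> sat phi (map_tuple f v).

Definition countably_infinite (V : vocabulary) (M : structure V) : Prop :=
  [set: M] #= [set: nat].

Definition omega_categorical (V : vocabulary) (T : set (sentence V)) : Prop :=
  [/\ forall M : structure V, model T M -> infinite_set [set: M],
      exists2 M : structure V, model T M & countably_infinite M &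
      forall M N : structure V, model T M -> model T N ->
        countably_infinite M -> countably_infinite N -> isomorphic M N].

(** * Simplicity *)

Definition tuple_in (T : Type) (A : set T) (m : nat) (c : m.-tuple T) : Prop :=
  forall i : 'I_m, A (tnth c i).

(* In [phi : formula V (n + m)%N] the first [n] variables are the object
   variables x and the last [m] the parameter variables y, so that phi(x, b) is
   given by the pair [phi], [b]. *)
Definition inst (V : vocabulary) (M : structure V) (n m : nat)
    (phi : formula V (n + m)%N) (b : m.-tuple M) : set (n.-tuple M) :=
  [set x : n.-tuple M | sat phi (cat_tuple x b)].

(* The family (phi(x, b i))_i is k-inconsistent: no k members of it with
   pairwise distinct indices have a common realization. *)
Definition k_inconsistent (V : vocabulary) (M : structure V) (n m : nat)
    (phi : formula V (n + m)%N) (k : nat) (b : nat -> m.-tuple M) : Prop :=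
  forall s : 'I_k -> nat, injective s ->
    ~ exists x : n.-tuple M, forall i : 'I_k, inst phi (b (s i)) x.

(* Consistency with the elementary diagram of M, i.e. finite satisfiability in
   M. *)
Definition consistent (V : vocabulary) (M : structure V) (n m : nat)
    (phi : formula V (n + m)%N) (b : nat -> m.-tuple M) : Prop :=
  forall l : nat, exists x : n.-tuple M,
    forall i : nat, (i < l)%N -> inst phi (b i) x.

(* The nodes of the tree omega^{<omega} are the [s : seq nat]; the successors
   of s are the [rcons s i], and the nodes of the branch sigma are the
   [mkseq sigma l]. *)
Definition tree_property (V : vocabulary) (T : set (sentence V)) (n m : nat)
    (phi : formula V (n + m)%N) : Prop :=
  exists (M : structure V) (k : nat) (b : seq nat -> m.-tuple M),
    [/\ model T M,
        forall s : seq nat, k_inconsistent phi k (fun i => b (rcons s i)) &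
        forall sigma : nat -> nat,
          consistent phi (fun l => b (mkseq sigma l))].

Definition simple (V : vocabulary) (T : set (sentence V)) : Prop :=
  forall (n m : nat) (phi : formula V (n + m)%N), ~ tree_property T phi.

(** * Forking and SU-rank *)

(* In the absence of a monster model, the definitions below pass to elementary
   extensions [f : M -> N] wherever new elements are needed. *)

Definition same_type (V : vocabulary) (M : structure V) (A : set M) (n : nat)
    (a a' : n.-tuple M) : Prop :=
  forall (m : nat) (phi : formula V (n + m)%N) (c : m.-tuple M),
    tuple_in A c -> (inst phi c a <-> inst phi c a').

Definition divides (V : vocabulary) (M : structure V) (A : set M) (n m : nat)
    (phi : formula V (n + m)%N) (b : m.-tuple M) : Prop :=
  exists (N : structure V) (f : M -> N) (k : nat) (bs : nat -> m.-tuple N),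
    [/\ elementary f,
        forall i : nat, same_type (f @` A) (bs i) (map_tuple f b) &
        k_inconsistent phi k bs].

Definition forks (V : vocabulary) (M : structure V) (A : set M) (n m : nat)
    (phi : formula V (n + m)%N) (b : m.-tuple M) : Prop :=
  exists (N : structure V) (f : M -> N) (p : nat) (q : 'I_p -> nat)
         (psi : forall j : 'I_p, formula V (n + q j)%N)
         (c : forall j : 'I_p, (q j).-tuple N),
    [/\ elementary f,
        inst phi (map_tuple f b) `<=` \bigcup_j inst (psi j) (c j) &
        forall j : 'I_p, divides (f @` A) (psi j) (c j)].

(* tp(a/B) forks over A. As tp(a/B) is closed under conjunction, it implies a
   formula that forks over A iff it contains one. *)
Definition type_forks (V : vocabulary) (M : structure V) (A B : set M) (n : nat)
    (a : n.-tuple M) : Prop :=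
  exists (m : nat) (phi : formula V (n + m)%N) (b : m.-tuple M),
    [/\ tuple_in B b, inst phi b a & forks A phi b].

(* SU(tp(a/A)) >= d: SU(p) >= d + 1 iff p has a forking extension q with
   SU(q) >= d. *)
Fixpoint SU_ge (V : vocabulary) (d : nat) (M : structure V) (A : set M)
    (n : nat) (a : n.-tuple M) : Prop :=
  match d with
  | 0%N => True
  | d'.+1 =>
    exists (N : structure V) (f : M -> N) (B : set N) (a' : n.-tuple N),
      [/\ elementary f,
          f @` A `<=` B,
          same_type (f @` A) a' (map_tuple f a),
          type_forks (f @` A) B a' &
          SU_ge d' B a']
  end.

(* The SU-rank of T is the supremum of the SU-ranks of its complete 1-types.
   The types over the empty set suffice, as the SU-rank of a type does not
   exceed that of its restrictions. *)
Definition SU_rank (V : vocabulary) (T : set (sentence V)) (d : nat) : Prop :=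
  (forall (M : structure V) (a : 1.-tuple M),
     model T M -> ~ SU_ge d.+1 set0 a) /\
  (exists (M : structure V) (a : 1.-tuple M), model T M /\ SU_ge d set0 a).

(** * Algebraic closure *)

Definition acl (V : vocabulary) (M : structure V) (X : set M) : set M :=
  [set a | exists (m : nat) (phi : formula V (1 + m)%N) (b : m.-tuple M),
     [/\ tuple_in X b, inst phi b [tuple a] & finite_set (inst phi b)]].

Definition trivial_pregeometry (V : vocabulary) (T : set (sentence V)) : Prop :=
  forall (M : structure V) (X : set M), model T M ->
    acl X = X `|` acl set0.

(** * Almost sure theories *)

(* Sets of structures are bare predicates, and finiteness and probability
   measures are spelled out for them: instantiating the library's [set],
   [finite_set] or measures at [structure V] would place the carriers in a
   universe strictly below that of the library's types, and so forbid carriers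
   such as 'I_n. *)

Definition finite_pred (U : Type) (K : U -> Prop) : Prop :=
  exists (p : nat) (e : 'I_p -> U),
    forall x : U, K x -> exists i : 'I_p, e i = x.

(* A probability measure on the sigma-algebra of all subsets of K, for K finite:
   additivity is then equivalent to countable additivity. *)
Definition probability_on (R : realType) (U : Type) (K : U -> Prop)
    (mu : (U -> Prop) -> R) : Prop :=
  [/\ forall A : U -> Prop, (forall x, A x -> K x) -> 0 <= mu A,
      forall A B : U -> Prop,
        (forall x, A x -> K x) -> (forall x, B x -> K x) ->
        (forall x, ~ (A x /\ B x)) ->
        mu (fun x => A x \/ B x) = mu A + mu B &
      mu K = 1].

Definition finite_structure (V : vocabulary) (M : structure V) : Prop :=
  finite_set [set: M].

Definition finite_structure_probabilities (R : realType) (V : vocabulary)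
    (K : nat -> structure V -> Prop) (mu : nat -> (structure V -> Prop) -> R) :
    Prop :=
  forall n : nat,
    [/\ exists N : structure V, K n N,
        finite_pred (K n),
        forall N : structure V, K n N -> finite_structure N &
        probability_on (K n) (mu n)].

Definition almost_sure (R : realType) (V : vocabulary)
    (K : nat -> structure V -> Prop) (mu : nat -> (structure V -> Prop) -> R)
    (phi : sentence V) : Prop :=
  (fun n => mu n (fun N => K n N /\ holds N phi)) @ \oo --> (1 : R).

Definition almost_sure_theory (R : realType) (V : vocabulary)
    (K : nat -> structure V -> Prop) (mu : nat -> (structure V -> Prop) -> R) :
    set (sentence V) :=
  [set phi | almost_sure K mu phi].

(* Main.v *)
From Stdlib Require List.
Require Import Defs.
From mathcomp Require Import all_boot all_order all_algebra.
From mathcomp Require Import all_classical all_reals all_analysis.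
From mathcomp Require Import zify.

(** The almost sure theory of a sequence of one-point families {N_n} consists of
    the sentences that hold in all but finitely many N_n. As [T] is complete, it
    is therefore enough that [T] be pseudofinite: for each bound on the
    quantifier depth, some finite structure agrees with the countable model M of
    [T] on all sentences below that bound ([pseudofinite]).

    Model theory of M. A type that is not isolated is omitted by some countable
    model ([generic_model]), and M is the only countable model, so all types are
    isolated and finite in number ([isolated], [finitely_many_types]); hence M is
    homogeneous, its automorphism group G has finitely many orbits on n-tuples
    ([homogeneous], [oligomorphic]), and G-invariant relations are definable.
    Triviality says that a finite set invariant over b lies in the union of b and
    acl(0) ([acl_finite_orbits]). Rank one says that the finite subsets of M form
    an S1 ideal: the conjugates of an infinite definable set W(., b) are not
    k-inconsistent, for otherwise a point of W(., b) outside acl(b) would start a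
    forking chain of length two ([consistent_along_orbit]).

    Independence. The rest concerns permutation groups with these properties.
    Let E be the finest G-invariant equivalence relation of finite index, and G0
    the subgroup of G that fixes every class of E. Call two pairs of points
    equally labelled if they are G0-conjugate. The main point is [amalgamation]:
    over a finite set a of points outside acl(0), arbitrary labels between a new
    point x and the single points of a are realized simultaneously, provided that
    they are compatible with E. One adds the points b of a one at a time. The
    relation R(a, b), that labels over a and over b have a common realization, is
    stable: the realizations attached to the diagonal of a half graph of R would
    be infinite and pairwise disjoint, against S1 ([no_half_graph]). Conversely,
    if infinitely many of the sets R(a, .) differed pairwise by infinite sets,
    S1 for these differences and Ramsey's theorem would give long half graphs.
    So there are finitely many sets R(a, .) up to finite differences
    ([sim_fin_index]), and for b outside a and acl(0) the truth of R(a, b)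
    depends on the E-class of b only ([same_amalgams_congruence]). For some point
    b of the class R(a, b) holds: realize the labels over a by some x, and then
    move a point with the correct label over x away from a, by triviality.

    Finite structures. Take acl(0) together with m copies of representatives of
    the other classes of E, and choose the labels at random. For m large, all
    prescriptions of labels over at most q points are realized
    ([generic_extension]). By [amalgamation] the same extensions exist in M, so q
    rounds of back and forth are possible between the two
    ([finite_approximation]). The vocabulary is binary, so labels determine the
    relations, and sentences of depth at most q are preserved ([sat_labelled]). *)

Set Implicit Arguments.
Unset Strict Implicit.
Unset Printing Implicit Defensive.

(** * Formulas with named variables *)

Section Renaming.
Variable V : vocabulary.

Definition up_ren n m (f : 'I_n -> 'I_m) (i : 'I_n.+1) : 'I_m.+1 :=
  if unlift ord0 i is Some j then lift ord0 (f j) else ord0.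

Fixpoint rename n (phi : formula V n) : forall m, ('I_n -> 'I_m) -> formula V m :=
  match phi with
  | Fls => fun m _ => Fls V m
  | Eqn i j => fun m f => Eqn V (f i) (f j)
  | Rel r t => fun m f => Rel (map_tuple f t)
  | Imp p q => fun m f => Imp (rename p f) (rename q f)
  | All p => fun m f => All (rename p (up_ren f))
  end.

Lemma sat_rename (M : structure V) n m (phi : formula V n) (f : 'I_n -> 'I_m)
    (v : m.-tuple M) :
  sat (rename phi f) v <-> sat phi [tuple tnth v (f i) | i < n].
Proof.
elim: phi m f v => {n} [n|n i j|n r t|n p IHp q IHq|n p IHp] m f v //=.
- by rewrite !tnth_mktuple.
- suff -> : map_tuple (tnth v) (map_tuple f t) =
    map_tuple (tnth [tuple tnth v (f i) | i < n]) t by [].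
  by apply: eq_from_tnth => i; rewrite !tnth_map tnth_ord_tuple.
- by split=> h /IHp hp; apply/IHq; apply: h.
- have e x : [tuple tnth [tuple of x :: v] (up_ren f i) | i < n.+1]
      = [tuple of x :: [tuple tnth v (f i) | i < n]].
    apply: eq_from_tnth => i; rewrite tnth_mktuple /up_ren.
    case: unliftP => [j ->|->]; last by rewrite !tnth0.
    by rewrite !tnthS tnth_mktuple.
  split=> h x; first by rewrite -e; apply/IHp; apply: h.
  by apply/IHp; rewrite e; apply: h.
Qed.

Fixpoint all_first m n : formula V (m + n) -> formula V n :=
  match m return formula V (m + n) -> formula V n with
  | 0 => id
  | m'.+1 => fun phi => @all_first m' n (All phi)
  end.

Lemma sat_all_first (M : structure V) m n (phi : formula V (m + n))
    (v : n.-tuple M) :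
  sat (all_first phi) v <-> forall u : m.-tuple M, sat phi (cat_tuple u v).
Proof.
elim: m phi => [|m IHm] phi /=.
  split=> h => [u|]; last first.
    by have := h [tuple]; congr sat; apply: val_inj.
  by move: h; congr sat; apply: val_inj; rewrite /= (tuple0 u).
rewrite IHm; split=> h u => /=.
  have := h (behead_tuple u) (thead u).
  by congr sat; apply: val_inj; rewrite /= -cat_cons; case: u => -[].
move=> x; have := h [tuple of x :: u].
by congr sat; apply: val_inj.
Qed.

Lemma sat_eq (M : structure V) n (phi : formula V n) (u v : n.-tuple M) :
  tval u = tval v -> sat phi u -> sat phi v.
Proof. by move=> e; have -> : u = v by apply: val_inj. Qed.

End Renaming.

(** Naming the variables by natural numbers lets formulas of different arities
    be combined freely; they are evaluated at assignments [nat -> M]. *)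
Record nform (V : vocabulary) :=
  Nform { ndim : nat; nbody : formula V ndim; nvars : ndim.-tuple nat }.

Section Named.
Variable V : vocabulary.
Implicit Types p q : nform V.

Definition nimp p q : nform V :=
  Nform (Imp (rename (nbody p) (lshift (ndim q))) (rename (nbody q) (@rshift (ndim p) (ndim q))))
        (cat_tuple (nvars p) (nvars q)).
Definition nfls : nform V := Nform (Fls V 0) [tuple].
Definition neq (i j : nat) : nform V :=
  Nform (Eqn V (ord0 : 'I_2) (lift ord0 ord0)) [tuple i; j].
Definition nall (i : nat) p : nform V :=
  Nform (All (rename (nbody p)
    (fun j => if tnth (nvars p) j == i then ord0 else lift ord0 j))) (nvars p).
Definition nsubst (f : nat -> nat) p : nform V :=
  Nform (nbody p) (map_tuple f (nvars p)).
Definition nneg p := nimp p nfls.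
Definition nand p q := nneg (nimp p (nneg q)).
Definition nex i p := nneg (nall i (nneg p)).
Definition nands (l : seq (nform V)) := foldr nand (nneg nfls) l.
Definition nors (l : seq (nform V)) := nneg (nands (map nneg l)).
Definition nexs (l : seq nat) p := foldr nex p l.

Section Eval.
Variable M : structure V.
Implicit Types s : nat -> M.

Definition ev s p : Prop := sat (nbody p) (map_tuple s (nvars p)).

Definition upd s i x : nat -> M := fun j => if j == i then x else s j.

Lemma ev_ext s s' p : {in nvars p, s =1 s'} -> ev s p <-> ev s' p.
Proof.
move=> h; rewrite /ev; suff -> : map_tuple s (nvars p) = map_tuple s' (nvars p) by [].
by apply: val_inj; apply/eq_in_map.
Qed.

Lemma ev_imp s p q : ev s (nimp p q) <-> (ev s p -> ev s q).
Proof.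
rewrite /ev /= !sat_rename.
have -> : [tuple tnth (map_tuple s (cat_tuple (nvars p) (nvars q)))
            (lshift (ndim q) i)  | i < ndim p] = map_tuple s (nvars p).
  by apply: eq_from_tnth => i; rewrite tnth_mktuple !tnth_map tnth_lshift.
have -> : [tuple tnth (map_tuple s (cat_tuple (nvars p) (nvars q)))
            (rshift (ndim p) i)  | i < ndim q] = map_tuple s (nvars q).
  by apply: eq_from_tnth => i; rewrite tnth_mktuple !tnth_map tnth_rshift.
by [].
Qed.

Lemma ev_fls s : ev s nfls <-> False. Proof. by []. Qed.

Lemma ev_eq s i j : ev s (neq i j) <-> s i = s j. Proof. by []. Qed.

Lemma ev_all s i p : ev s (nall i p) <-> forall x, ev (upd s i x) p.
Proof.
have e x : [tuple tnth [tuple of x :: map_tuple s (nvars p)]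
    (if tnth (nvars p) j == i then ord0 else lift ord0 j) | j < ndim p]
    = map_tuple (upd s i x) (nvars p).
  have tnth_if m (w : m.-tuple M) b j :
    tnth [tuple of x :: w] (if b then ord0 else lift ord0 j)
    = if b then x else tnth w j by case: b; rewrite ?tnth0 ?tnthS.
  apply: eq_from_tnth => j; rewrite tnth_mktuple tnth_if [RHS]tnth_map tnth_map.
  by [].
rewrite /ev /=; split=> h x; first by rewrite -e; apply/sat_rename; apply: h.
by apply/sat_rename; rewrite e; apply: h.
Qed.

Lemma ev_subst s f p : ev s (nsubst f p) <-> ev (s \o f) p.
Proof.
rewrite /ev /=; suff -> : map_tuple s (map_tuple f (nvars p)) =
  map_tuple (s \o f) (nvars p) by [].
by apply: val_inj; rewrite /= map_comp.
Qed.

Lemma ev_neg s p : ev s (nneg p) <-> ~ ev s p.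
Proof. by rewrite ev_imp ev_fls. Qed.

Lemma ev_and s p q : ev s (nand p q) <-> ev s p /\ ev s q.
Proof.
rewrite ev_neg ev_imp ev_neg; split=> [h|[hp hq] /(_ hp)//].
by split; apply: contrapT => h'; apply: h.
Qed.

Lemma ev_ex s i p : ev s (nex i p) <-> exists x, ev (upd s i x) p.
Proof.
rewrite ev_neg ev_all; split=> [h|[x hx] /(_ x)]; last by rewrite ev_neg.
apply: contrapT => h'; apply: h => x; rewrite ev_neg => hx.
by apply: h'; exists x.
Qed.

Lemma ev_ands s l : ev s (nands l) <-> forall p, List.In p l -> ev s p.
Proof.
elim: l => [|p l IHl] /=; first by rewrite ev_neg ev_fls; split=> // _ [].
rewrite ev_and IHl; split=> [[h1 h2] q [<-//|/h2//]|h].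
by split=> [|q hq]; apply: h; [left|right].
Qed.

Lemma ev_ors s l : ev s (nors l) <-> exists2 p, List.In p l & ev s p.
Proof.
rewrite ev_neg ev_ands; split=> [h|[p pl hp]].
  apply: contrapT => h'; apply: h => _ /List.in_map_iff [p [<- pl]].
  by rewrite ev_neg => hp; apply: h'; exists p.
by move=> /(_ (nneg p)); rewrite ev_neg; apply => //; apply: List.in_map.
Qed.

Lemma ev_exs s l p : ev s (nexs l p) <->
  exists s', (forall i, i \notin l -> s' i = s i) /\ ev s' p.
Proof.
elim: l s => [|i l IHl] s /=.
  split=> [h|[s' [h1 h2]]]; first by exists s.
  by rewrite -(ev_ext (s := s')) // => i _; apply: h1.
rewrite ev_ex; split=> [[x /IHl [s' [h1 h2]]]|[s' [h1 h2]]].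
  exists s'; split=> // j; rewrite inE negb_or => /andP [/negPf ji jl].
  by rewrite h1 // /upd ji.
exists (s' i); apply/IHl; exists s'; split=> // j jl.
rewrite /upd; case: eqP => [->//|/eqP ji].
by apply: h1; rewrite inE negb_or ji.
Qed.

(** This is a semantic notion, because [nall] leaves the bound name in [nvars]. *)
Definition dep n p := forall s s' : nat -> M,
  (forall i, i < n -> s i = s' i) -> (ev s p <-> ev s' p).

Lemma depW n m p : n <= m -> dep n p -> dep m p.
Proof.
by move=> nm d s s' h; apply: d => i lt; apply: h; apply: leq_trans nm.
Qed.

Lemma ex_dep p : exists n, dep n p.
Proof.
exists (\max_(i <- nvars p) i).+1 => s s' h; apply: ev_ext => i ip.
by apply: h; rewrite ltnS; apply: leq_bigmax_seq.
Qed.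

(** Names outside the first [n] do not affect the truth value, so they may be
    quantified universally. Each name gets one quantifier, that of its first
    occurrence in [nvars]. *)
Lemma dep_formula n p : dep n p ->
  exists phi : formula V n, forall s : nat -> M,
    sat phi (map_tuple s [tuple of iota 0 n]) <-> ev s p.
Proof.
move=> d; set m := ndim p.
have lti (j : 'I_m) : index (tnth (nvars p) j) (nvars p) < m.
  by rewrite -[X in _ < X](size_tuple (nvars p)) index_mem mem_tnth.
pose f (j : 'I_m) : 'I_(m + n) :=
  if insub (tnth (nvars p) j) is Some k then rshift m k
  else lshift n (Ordinal (lti j)).
exists (all_first (rename (nbody p) f)) => s.
rewrite sat_all_first.
have key (u : m.-tuple M) : exists s', (forall i, i < n -> s' i = s i) /\
    (sat (rename (nbody p) f)
       (cat_tuple u (map_tuple s [tuple of iota 0 n])) <-> ev s' p).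
  pose s' i := if i < n then s i else nth (s 0) u (index i (nvars p)).
  exists s'; split=> [i lt|]; first by rewrite /s' lt.
  rewrite sat_rename /ev; suff -> : map_tuple s' (nvars p) = [tuple tnth (cat_tuple u
       (map_tuple s [tuple of iota 0 n])) (f i)  | i < ndim p] by [].
  apply: eq_from_tnth => j; rewrite tnth_map tnth_mktuple /f /s'.
  case: insubP => [k kn <-|/negPf ->].
    by rewrite ltn_ord tnth_rshift tnth_map (tnth_nth 0) /= nth_iota.
  by rewrite tnth_lshift (tnth_nth (s 0)).
split=> h.
  have [s' [h1 h2]] := key [tuple s 0 | _ < m].
  by rewrite (d s s') // -?h2 // => i lt; rewrite h1.
by move=> u; have [s' [h1 ->]] := key u; rewrite (d s' s).
Qed.

End Eval.
End Named.

(** * Countability of the language *)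

Section Countability.
Variable V : vocabulary.
Local Notation tree := (GenTree.tree nat).

Fixpoint code_formula n (phi : formula V n) : tree :=
  match phi with
  | Fls => GenTree.Node 0 [::]
  | Eqn i j => GenTree.Node 1 [:: GenTree.Leaf (pickle (i, j))]
  | Rel r t => GenTree.Node 2
     [:: GenTree.Leaf (pickle (Tagged (fun r => (arity r).-tuple 'I_n) t))]
  | Imp p q => GenTree.Node 3 [:: code_formula p; code_formula q]
  | All p => GenTree.Node 4 [:: code_formula p]
  end.

Fixpoint decode_formula (t : tree) (n : nat) : option (formula V n) :=
  match t with
  | GenTree.Node 0 _ => Some (Fls V n)
  | GenTree.Node 1 [:: GenTree.Leaf k] =>
      omap (fun ij : 'I_n * 'I_n => Eqn V ij.1 ij.2) (unpickle k)
  | GenTree.Node 2 [:: GenTree.Leaf k] =>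
      omap (fun rt : {r : symb V & (arity r).-tuple 'I_n} => Rel (tagged rt))
        (unpickle k)
  | GenTree.Node 3 [:: t1; t2] =>
      if decode_formula t1 n is Some p then
        omap (Imp p) (decode_formula t2 n) else None
  | GenTree.Node 4 [:: t1] => omap (@All V n) (decode_formula t1 n.+1)
  | _ => None
  end.

Lemma code_formulaK n (phi : formula V n) :
  decode_formula (code_formula phi) n = Some phi.
Proof.
elim: phi => {n} [n|n i j|n r t|n p IHp q IHq|n p IHp] //=.
- by rewrite pickleK.
- by rewrite pickleK.
- by rewrite IHp IHq.
- by rewrite IHp.
Qed.

Definition code_nform (p : nform V) : nat :=
  pickle (ndim p, code_formula (nbody p), tval (nvars p)).

Definition decode_nform (k : nat) : option (nform V) :=
  if unpickle k is Some (n, t, s) then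
    if decode_formula t n is Some phi then
      if insub s is Some v then Some (@Nform V n phi v) else None
    else None
  else None.

Lemma code_nformK : pcancel code_nform decode_nform.
Proof.
by case=> n phi v; rewrite /decode_nform pickleK code_formulaK valK.
Qed.

Lemma nform_enum : exists e : nat -> nform V, forall p, exists k, e k = p.
Proof.
exists (odflt (nfls V) \o decode_nform) => p.
by exists (code_nform p); rewrite /= code_nformK.
Qed.

Lemma sentence_enum : exists e : nat -> sentence V, forall p, exists k, e k = p.
Proof.
pose d k : sentence V := if unpickle k is Some t then
  odflt (Fls V 0) (decode_formula t 0) else Fls V 0.
exists d => p; exists (pickle (code_formula p)).
by rewrite /d pickleK code_formulaK.
Qed.

End Countability.

(** * Countable generic models *)

Section Generic.
Variables (V : vocabulary) (M : structure V).

(** The condition [C] names a counterexample to [p] if [p] is universal and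
    fails. *)
Definition henkin (p C : nform V) : Prop :=
  match p with Nform n phi v =>
    (match phi with
     | All psi => fun v => exists x, forall s : nat -> M, ev s C ->
         sat psi [tuple of s x :: map_tuple s v] ->
         forall y, sat psi [tuple of y :: map_tuple s v]
     | _ => fun _ => True
     end) v
  end.

Variables (L : nform V -> Prop) (C0 : nform V) (n0 : nat).
Variable B : nat -> nform V -> Prop.
Hypothesis L_sat : forall C, L C -> exists s : nat -> M, ev s C.
Hypothesis L_split : forall C p, L C -> L (nand C p) \/ L (nand C (nneg p)).
Hypothesis L_fresh : forall C C' n, L C -> dep M n C -> n0 <= n ->
  (forall s : nat -> M, ev s C -> exists y, ev (upd s n y) C') -> L C'.
Hypothesis L_task : forall t C, L C -> exists2 q, B t q & L (nand C q).
Hypothesis L_start : L C0.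

Let refines C' C := forall s : nat -> M, ev s C' -> ev s C.

Let step t (p C C' : nform V) : Prop :=
  [/\ L C', refines C' C,
      refines C' p \/ (forall s : nat -> M, ev s C' -> ~ ev s p),
      henkin p C' & exists2 q, B t q & refines C' q].

Let step_ex t p C : L C -> exists C', step t p C C'.
Proof.
move=> LC.
have [C1 [L1 r1 d1]] : exists C1, [/\ L C1, refines C1 C &
    refines C1 p \/ (forall s : nat -> M, ev s C1 -> ~ ev s p)].
  case: (L_split p LC) => LC1; eexists; split; try exact: LC1.
  - by move=> s /ev_and [].
  - by left=> s /ev_and [].
  - by move=> s /ev_and [].
  - by right=> s /ev_and [_ /ev_neg].
have [q Bq L2] := L_task t L1.
have r2 : refines (nand C1 q) C1 by move=> s /ev_and [].
suff [C3 [L3 r3 h3]] : exists C3, [/\ L C3, refines C3 (nand C1 q) & henkin p C3].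
  exists C3; split=> //; first by move=> s /r3/r2/r1.
    by case: d1 => d1; [left|right] => s /r3/r2/d1.
  by exists q => // s /r3 /ev_and [].
case: p d1 => n [|i j|r t'|p1 p2|psi] v _; try by exists (nand C1 q); split.
have [k0 dk0] := ex_dep M (nand C1 q).
pose k := maxn n0 (maxn k0 (\max_(i <- v) i).+1).
have kv i : i \in tval v -> i < k.
  move=> iv; rewrite !leq_max ltnS; apply/orP; right; apply/orP; right.
  exact: leq_bigmax_seq.
exists (nand (nand C1 q)
  (nimp (Nform psi [tuple of k :: v]) (Nform (All psi) v))); split.
- apply: (L_fresh L2 (n := k)); first by apply: depW dk0; rewrite !leq_max leqnn orbT.
    by rewrite leq_max leqnn.
  move=> s sC.
  have ev_updv y : map_tuple (upd s k y) v = map_tuple s v.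
    apply: val_inj; apply/eq_in_map => i /kv; rewrite /upd.
    by case: eqP => // ->; rewrite ltnn.
  have H y : ev (upd s k y) (nand C1 q).
    rewrite -((depW (n := k0) (m := k) _ dk0) s) // ?leq_max ?leqnn ?orbT // => i.
    by rewrite /upd; case: eqP => // ->; rewrite ltnn.
  have [y hy] : exists y, sat psi [tuple of y :: map_tuple s v] ->
      forall y, sat psi [tuple of y :: map_tuple s v].
    case: (pselect (exists y, ~ sat psi [tuple of y :: map_tuple s v])).
      by move=> [y hy]; exists y.
    by move=> /forallNP h; exists (s 0) => _ y; apply: contrapT.
  exists y; apply/ev_and; split=> //; apply/ev_imp.
  have ev_updl (z : M) : [seq upd s k z i | i <- v] = map s v.
    exact: (congr1 (@tval n M) (ev_updv z)).
  rewrite /ev /= => h x; apply: (sat_eq (u := [tuple of x :: map_tuple s v])).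
    by rewrite /= ev_updl.
  apply: hy; apply: sat_eq h.
  by rewrite /= ev_updl /upd eqxx.
- by move=> s /ev_and [].
- exists k => s /ev_and [_ /ev_imp h] h'; apply: h; rewrite /ev /=.
  suff -> : map_tuple s [tuple of k :: v] =
     [tuple of s k :: map_tuple s v] by [].
  exact: val_inj.
Qed.

(** Conditions are named formulas, and [L] singles out those that are large
    enough to be kept. A decreasing sequence of conditions decides every formula,
    names witnesses and performs the tasks [B]; what it forces is the diagram of a
    countable model whose points are the variables up to forced equality. When
    [L C] says that [C] is satisfiable and each task refutes some formula of a
    type at one tuple of variables, this is the omitting types theorem. *)
Lemma generic_model :
  exists (N : structure V) (pi : nat -> N),
    [/\ forall y, exists i, pi i = y,
        forall phi : sentence V, holds N phi <-> holds M phi &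
        forall t, exists2 q, B t q & ev pi q].
Proof.
have [e he] := nform_enum V.
have /choice [nxt hnxt] : forall tC : nat * nform V, exists C',
    L tC.2 -> step tC.1 (e tC.1) tC.2 C'.
  move=> [t C] /=; case: (pselect (L C)) => [/(step_ex t (e t)) [C' hC']|nL].
    by exists C'.
  by exists C.
pose fix Cs k := if k is k'.+1 then nxt (k', Cs k') else C0.
have LCs k : L (Cs k).
  by elim: k => // k IHk /=; have [] := hnxt (k, Cs k) IHk.
have hCs k : step k (e k) (Cs k) (Cs k.+1) := hnxt (k, Cs k) (LCs k).
have rCs k l : k <= l -> refines (Cs l) (Cs k).
  move=> /subnKC <-; elim: (l - k) => [|d IHd]; first by rewrite addn0.
  by rewrite addnS => s; have [_ r _ _ _] := hCs (k + d) => /r/IHd.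
(* G is the set of formulas forced by the sequence of conditions. *)
pose G p := exists k, refines (Cs k) p.
have Gmon (p q r : nform V) : G p -> G q ->
    (forall s : nat -> M, ev s p -> ev s q -> ev s r) -> G r.
  move=> [k hk] [l hl] h; exists (maxn k l) => s hs.
  by apply: h; [apply: hk|apply: hl]; apply: rCs hs; rewrite leq_max leqnn ?orbT.
have Gmon1 (p r : nform V) : G p ->
    (forall s : nat -> M, ev s p -> ev s r) -> G r.
  by move=> Gp h; apply: (Gmon p p) => // s /h.
have Gtrue (p : nform V) : (forall s : nat -> M, ev s p) -> G p.
  by move=> h; exists 0.
have Gdec p : G p \/ G (nneg p).
  have [k <-] := he p; have [_ _ d _ _] := hCs k.
  case: d => d; first by left; exists k.+1.
  by right; exists k.+1 => s /d /ev_neg.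
have Gcons p : ~ (G p /\ G (nneg p)).
  move=> [Gp Gn]; have [k hk] : G (nfls V).
    by apply: (Gmon _ _ _ Gp Gn) => s hp /ev_neg /(_ hp).
  by have [s /hk] := L_sat (LCs k).
have Grefl i : G (neq V i i) by apply: Gtrue.
have ex_rep i : exists j, `[< G (neq V j i) >] by exists i; apply/asboolP.
pose rep i := ex_minn (ex_rep i).
have Grep i : G (neq V (rep i) i).
  by rewrite /rep; case: ex_minnP => j /asboolP.
have rep_le i j : G (neq V j i) -> rep i <= j.
  by move=> h; rewrite /rep; case: ex_minnP => k _; apply; apply/asboolP.
have rep_eq i j : rep i = rep j <-> G (neq V i j).
  split=> [eij|h].
    apply: (Gmon _ _ _ (Grep i) (Grep j)) => s; rewrite !ev_eq => <- <-.
    by rewrite eij.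
  apply/eqP; rewrite eqn_leq; apply/andP; split; apply: rep_le.
    by apply: (Gmon _ _ _ (Grep j) h) => s; rewrite !ev_eq => -> ->.
  by apply: (Gmon _ _ _ (Grep i) h) => s; rewrite !ev_eq => -> ->.
have rep_idem i : rep (rep i) = rep i by apply/rep_eq.
have Glist (l : seq nat) : exists k, forall s : nat -> M, ev s (Cs k) ->
    map s l = map s (map rep l).
  elim: l => [|i l [k hk]]; first by exists 0.
  have [k' hk'] := Grep i; exists (maxn k k') => s hs /=.
  rewrite -hk; last by apply: rCs hs; rewrite leq_max leqnn.
  congr cons; by apply/esym; apply: hk'; apply: rCs hs; rewrite leq_max leqnn orbT.
have Gcong n (phi : formula V n) (v : n.-tuple nat) :
    G (Nform phi v) <-> G (Nform phi (map_tuple rep v)).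
  have [k hk] := Glist v.
  have h (s : nat -> M) : ev s (Cs k) -> (ev s (Nform phi v) <->
      ev s (Nform phi (map_tuple rep v))).
    move=> hs; have e1 := hk _ hs; rewrite /ev /=.
    suff -> : map_tuple s v = map_tuple s (map_tuple rep v) by [].
    exact: val_inj.
  by split=> Gp; apply: (Gmon _ (Cs k) _ Gp) => [|s hp hs];
    [exists k|apply/(h s hs)|exists k|apply/(h s hs)].
(* The points are the least variables in their classes of forced equality. *)
pose U := {i : nat | rep i == i}.
have rep_fix i : rep (rep i) == rep i by rewrite rep_idem.
pose pi i : U := exist _ (rep i) (rep_fix i).
pose I (r : symb V) (t : (arity r).-tuple U) : Prop :=
  G (Nform (Rel (ord_tuple (arity r))) (map_tuple val t)).
pose N := @Structure V U I (inhabits (pi 0)).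
have pi_val (u : U) : pi (val u) = u.
  by apply: val_inj; apply/eqP; apply: (valP u).
have truth n (phi : formula V n) (v : n.-tuple nat) :
    sat (M := N) phi (map_tuple pi v) <-> G (Nform phi v).
  elim: phi v => {n} [n|n i j|n r t|n p IHp q IHq|n p IHp] v /=.
  - by split=> // Gf; apply: (Gcons _ (conj Gf _)); apply: Gtrue => s; apply/ev_neg.
  - rewrite !tnth_map; split=> [/(congr1 val)/= /rep_eq Gij|Gij].
      by apply: (Gmon1 _ _ Gij) => s; rewrite /ev /= !tnth_map.
    apply: val_inj; apply/rep_eq.
    by apply: (Gmon1 _ _ Gij) => s; rewrite /ev /= !tnth_map.
  - rewrite /I (Gcong _ (Rel t) v).
    have h (s : nat -> M) : ev s (Nform (Rel (ord_tuple (arity r)))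
       (map_tuple val (map_tuple (tnth (map_tuple pi v)) t))) <->
       ev (M := M) s (Nform (Rel t) (map_tuple rep v)).
      rewrite /ev /=; set t1 := map_tuple _ _; set t2 := map_tuple _ _.
      suff -> : t1 = t2 by [].
      by apply: eq_from_tnth => i; rewrite !tnth_map tnth_ord_tuple.
    by split=> Gp; apply: (Gmon1 _ _ Gp) => s /h.
  - have himp : G (Nform (Imp p q) v) <->
       (G (Nform p v) -> G (Nform q v)).
      split=> [Gpq Gp|h].
        by apply: (Gmon _ _ _ Gpq Gp) => s; rewrite /ev /= => h /h.
      case: (Gdec (Nform p v)) => [/h Gq|Gp].
        by apply: (Gmon1 _ _ Gq) => s hq _.
      by apply: (Gmon1 _ _ Gp) => s /ev_neg hp /hp.
    by rewrite himp IHp IHq.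
  - have cons_pi i : [tuple of pi i :: map_tuple pi v] =
        map_tuple pi [tuple of i :: v] by apply: val_inj.
    split=> [h|Gall x].
      have [k hk] := he (Nform (All p) v); have := hCs k.
      rewrite hk => -[_ _ _ /= [x hx] _].
      have Gx : G (Nform p [tuple of x :: v]).
        by apply/IHp; rewrite -cons_pi; apply: h.
      apply: (Gmon _ (Cs k.+1) _ Gx); first by exists k.+1.
      move=> s h1 h2 y; apply: (hx s h2); move: h1; rewrite /ev /=.
      suff -> : map_tuple s [tuple of x :: v] = [tuple of s x :: map_tuple s v] by [].
      exact: val_inj.
    rewrite -(pi_val x) cons_pi; apply/IHp.
    apply: (Gmon1 _ _ Gall) => s h; have := h (s (val x)); rewrite /ev /=.
    suff -> : map_tuple s [tuple of val x :: v] =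
       [tuple of s (val x) :: map_tuple s v] by [].
    exact: val_inj.
exists N, pi; split=> [y|phi|t].
- by exists (val y); apply: pi_val.
- have e0 (X : Type) (t : 0.-tuple X) : t = [tuple of [::]] by apply: val_inj; rewrite tuple0.
  rewrite /holds -(e0 _ (map_tuple pi [tuple of [::]])).
  have evE (s : nat -> M) : ev (M := M) s (Nform phi [tuple of [::]]) <-> holds M phi.
    by rewrite /ev /= (e0 _ (map_tuple _ _)).
  rewrite truth; split=> [[k hk]|h].
    have [s hs] := L_sat (LCs k); apply/evE; exact: hk hs.
  by apply: Gtrue => s; apply/evE.
- have [_ _ _ _ [q Bq rq]] := hCs t; exists q => //.
  by apply/truth; case: q rq {Bq} => n phi v rq; exists t.+1.
Qed.

End Generic.

(** * Types in omega-categorical theories *)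

Section Isomorphisms.
Local Open Scope classical_set_scope.
Variable V : vocabulary.

Definition isomorphism (M N : structure V) (f : M -> N) : Prop :=
  bijective f /\ forall (r : symb V) (t : (arity r).-tuple M),
    interp t <-> interp (map_tuple f t).

Lemma sat_iso (M N : structure V) (f : M -> N) n (phi : formula V n)
    (v : n.-tuple M) :
  isomorphism f -> sat phi v <-> sat phi (map_tuple f v).
Proof.
move=> [[g fK gK] fI].
elim: phi v => {n} [n|n i j|n r t|n p IHp q IHq|n p IHp] v //=.
- by rewrite !tnth_map; split=> [->//|]; apply: (can_inj fK).
- rewrite fI; set t1 := map_tuple _ _; set t2 := map_tuple _ _.
  suff -> : t1 = t2 by [].
  by apply: eq_from_tnth => i; rewrite !tnth_map.
- by rewrite -IHp -IHq.
- split=> h x.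
    have /IHp := h (g x); apply: sat_eq.
    by rewrite /= gK.
  by apply/IHp; apply: sat_eq (h (f x)).
Qed.

Lemma ev_iso (M N : structure V) (f : M -> N) (s : nat -> M) p :
  isomorphism f -> ev (f \o s) p <-> ev s p.
Proof.
move=> fi; rewrite /ev [X in _ <-> X](sat_iso _ _ fi).
by split; apply: sat_eq; rewrite /= -map_comp.
Qed.

End Isomorphisms.

Section OmegaCategorical.
Local Open Scope classical_set_scope.
Variables (V : vocabulary) (T : set (sentence V)).
Hypothesis hcat : omega_categorical T.
Variable M : structure V.
Hypotheses (modM : model T M) (ctM : countably_infinite M).

Lemma countable_iso (N : structure V) (pi : nat -> N) :
  (forall y, exists i, pi i = y) -> model T N ->
  exists2 f : M -> N, isomorphism f & exists2 g, cancel f g & cancel g f.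
Proof.
move=> pi_surj modN; have [inf _ cat] := hcat.
have [] := cat M N modM modN ctM.
  apply: eq_card_nat (inf _ modN).
  have /choice [h hh] := pi_surj.
  by apply/countable_injP; exists h => x y _ _ e; rewrite -(hh x) -(hh y) e.
move=> f [[g fK gK] fI]; exists f; first by split=> //; exists g.
by exists g.
Qed.

Lemma enumM : exists en : nat -> M, forall y, exists i, en i = y.
Proof.
have /countable_injP [h hi] : countable [set: M].
  by rewrite (eq_countable ctM); apply: countableP.
have [x0] : inhabited M by apply: carrier_inhabited.
exists (fun i => if pselect (exists y, h y = i) is left e then projT1 (cid e) else x0).
move=> y; exists (h y); case: pselect => [e|]; last by case; exists y.
by case: cid => /= z; apply: hi; rewrite inE.
Qed.

(** Every model is elementarily equivalent to a countable one, by
    [generic_model] without tasks, and there is only one of those. *)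
Lemma complete_theory (N : structure V) (phi : sentence V) :
  model T N -> holds N phi <-> holds M phi.
Proof.
move=> modN.
pose L C := exists s : nat -> N, ev s C.
have [|||||N' [pi [pi_surj ee _]]] := @generic_model V N L (nneg (nfls V)) 0 (fun _ _ => True).
- by [].
- move=> C p [s sC]; case: (pselect (ev s p)) => sp; [left|right]; exists s.
    by apply/ev_and.
  by apply/ev_and; split=> //; apply/ev_neg.
- by move=> C C' n [s sC] _ _ /(_ s sC) [y hy]; exists (upd s n y).
- move=> _ C [s sC]; exists (nneg (nfls V)) => //; exists s.
  by apply/ev_and; split=> //; apply/ev_neg.
- have [x0] : inhabited N by apply: carrier_inhabited.
  by exists (fun=> x0); apply/ev_neg.
have [|f fi _] := countable_iso pi_surj; first by move=> p /modN; rewrite -ee.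
rewrite -ee; rewrite /holds; rewrite [sat (M := M) _ _](sat_iso _ _ fi).
by split; apply: sat_eq.
Qed.

Definition tpeq n (s s' : nat -> M) : Prop :=
  forall p, dep M n p -> ev s p <-> ev s' p.

Lemma tpeq_ext n s s' s1 s1' :
  (forall i, i < n -> s i = s1 i) -> (forall i, i < n -> s' i = s1' i) ->
  tpeq n s s' -> tpeq n s1 s1'.
Proof. by move=> h h' H p d; rewrite -(d s s1) // -(d s' s1') //; apply: H. Qed.

(** Definable sets of assignments are closed under the projection that sends
    [s'] to [s' \o f]; the variables of [C] are shifted by [n] to make room for
    those of [s]. *)
Lemma nproj (C : nform V) (f : nat -> nat) n : exists p, forall s : nat -> M,
  ev s p <-> exists s', ev s' C /\ forall i, i < n -> s' (f i) = s i.
Proof.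
have [k0 dC] := ex_dep M C.
pose K := maxn k0 (\max_(i < n) f i).+1.
have fK i : i < n -> f i < K.
  by move=> lt; rewrite leq_max ltnS (leq_bigmax (Ordinal lt)) orbT.
exists (nexs (iota n K) (nand (nsubst (addn n) C)
   (nands [seq neq V i (n + f i) | i <- iota 0 n]))) => s.
rewrite ev_exs; split=> [[s' [ss' /ev_and [/ev_subst h1 /ev_ands h2]]]|[s' [h1 h2]]].
  exists (s' \o addn n); split=> // i lt /=.
  have /ev_eq <- : ev s' (neq V i (n + f i)).
    apply: h2; apply: (List.in_map (fun i => neq V i (n + f i))).
    have : i \in iota 0 n by rewrite mem_iota.
    elim: (iota 0 n) => //= a l IHl; rewrite inE => /orP [/eqP ->|/IHl]; by [left|right].
  by apply: ss'; rewrite mem_iota leqNgt lt.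
exists (fun i => if n <= i < n + K then s' (i - n) else s i); split.
  by move=> i; rewrite mem_iota => /negPf ->.
apply/ev_and; split.
  apply/ev_subst; apply: (proj1 (dC s' _ _)) h1 => i ik /=.
  by rewrite leq_addr ltn_add2l (leq_trans ik (leq_maxl _ _)) addnC addnK.
apply/ev_ands => _ /List.in_map_iff [i [<- ii]]; apply/ev_eq.
have {ii} : i \in iota 0 n.
  elim: (iota 0 n) ii => //= a l IHl [->|/IHl]; rewrite inE ?eqxx // => ->.
  by rewrite orbT.
rewrite mem_iota /= => lt.
by rewrite leqNgt lt /= leq_addr ltn_add2l fK // addnC addnK h2.
Qed.

Let code_fun (t : nat) : nat -> nat := nth 0 (odflt [::] (unpickle t)).

Let code_funP n (f : nat -> nat) : exists t, forall i, i < n -> code_fun t i = f i.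
Proof.
exists (pickle (mkseq f n)) => i lt.
by rewrite /code_fun pickleK /= nth_mkseq.
Qed.

(** Otherwise some countable model omits the type of [s0], while M, to which it
    is isomorphic, realizes it. The type can be avoided at every tuple [f] of
    variables: if a condition [C] forced [f] to have this type, then the
    projection of [C] along [f] would isolate it. *)
Lemma isolated n (s0 : nat -> M) : exists p,
  [/\ dep M n p, ev s0 p & forall s, ev s p -> tpeq n s0 s].
Proof.
apply: contrapT => noniso.
pose L C := exists s : nat -> M, ev s C.
pose B t q := exists q0, [/\ q = nneg (nsubst (code_fun t) q0), dep M n q0 &
  ev s0 q0].
have [|||||N [pi [pi_surj ee omit]]] := @generic_model V M L (nneg (nfls V)) 0 B.
- by [].
- move=> C p [s sC]; case: (pselect (ev s p)) => sp; [left|right]; exists s.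
    by apply/ev_and.
  by apply/ev_and; split=> //; apply/ev_neg.
- by move=> C C' m [s sC] _ _ /(_ s sC) [y hy]; exists (upd s m y).
- move=> t C [s1 s1C].
  apply: contrapT => h; apply: noniso.
  have H s : ev s C -> tpeq n s0 (s \o code_fun t).
    move=> sC p dp.
    have H1 q0 : dep M n q0 -> ev s0 q0 -> ev (s \o code_fun t) q0.
      move=> dq e0; apply: contrapT => nq; apply: h.
      exists (nneg (nsubst (code_fun t) q0)); first by exists q0.
      by exists s; apply/ev_and; split=> //; apply/ev_neg => /ev_subst.
    split; first exact: H1.
    move=> e1; apply: contrapT => /ev_neg e0.
    suff /ev_neg : ev (s \o code_fun t) (nneg p) by [].
    by apply: H1 => // u u' uu'; rewrite !ev_neg (dp u u').
  have [p hp] := nproj C (code_fun t) n.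
  have dp : dep M n p.
    by move=> u u' uu'; rewrite !hp; split=> -[s' [e1 e2]]; exists s'; split=> // i lt;
      rewrite e2 // uu'.
  exists p; split=> //.
    by apply/(H _ s1C _ dp)/hp; exists s1.
  move=> s /hp [s' [s'C e]] q dq; rewrite (H _ s'C _ dq).
  exact: dq.
- by exists s0; apply/ev_neg.
have [|f fi [g fK gK]] := countable_iso pi_surj; first by move=> p /modM; rewrite -ee.
have /choice [h hh] := pi_surj.
have [t ht] := code_funP n (h \o f \o s0).
have [_ [q0 [-> dq e0]]] := omit t; rewrite ev_neg ev_subst; apply.
have -> : pi \o code_fun t = f \o (g \o pi \o code_fun t).
  by apply/funext => i /=; rewrite gK.
rewrite ev_iso //; apply: (proj1 (dq s0 _ _)) e0 => i lt /=.
by rewrite ht //= hh fK.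
Qed.

Lemma tpeq_sym n s s' : tpeq n s s' -> tpeq n s' s.
Proof. by move=> h p /h ->. Qed.
Lemma tpeq_trans n s s' s'' : tpeq n s s' -> tpeq n s' s'' -> tpeq n s s''.
Proof. by move=> h h' p d; rewrite h // h'. Qed.

(** Otherwise the conditions that admit infinitely many types of the first [n]
    variables are large, and refuting the isolating formulas of all tuples of M
    one after the other gives a countable model with an [n]-tuple whose type is
    not realized in M. *)
Lemma finitely_many_types n : exists l : seq (nat -> M), forall s,
  exists2 t, List.In t l & tpeq n t s.
Proof.
apply: contrapT => inf.
have {}inf (l : seq (nat -> M)) : exists s, forall t, List.In t l -> ~ tpeq n t s.
  apply: contrapT => /forallNP h; apply: inf; exists l => s.
  apply: contrapT => h'; apply: (h s) => t tl ts; apply: h'; by exists t.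
have /choice [P hP] := isolated n.
have [en en_surj] := enumM.
pose st t := en \o code_fun t.
pose L C := forall l : seq (nat -> M), exists2 s, ev s C &
  forall t, List.In t l -> ~ tpeq n t s.
pose B t q := q = nneg (P (st t)).
have [|||||N [pi [pi_surj ee omit]]] := @generic_model V M L (nneg (nfls V)) n B.
- by move=> C /(_ [::]) [s sC _]; exists s.
- move=> C p LC; apply: contrapT => /not_orP [/existsNP [l1 h1] /existsNP [l2 h2]].
  have [s sC hs] := LC (l1 ++ l2).
  have hs1 t : List.In t l1 -> ~ tpeq n t s.
    by move=> h; apply: hs; apply: List.in_or_app; left.
  have hs2 t : List.In t l2 -> ~ tpeq n t s.
    by move=> h; apply: hs; apply: List.in_or_app; right.
  case: (pselect (ev s p)) => sp; [apply: h1|apply: h2]; exists s => //.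
    by apply/ev_and.
  by apply/ev_and; split=> //; apply/ev_neg.
- move=> C C' m LC dC nm h l; have [s sC hs] := LC l.
  have [y hy] := h s sC; exists (upd s m y) => // t tl ts.
  apply: (hs t tl); apply: tpeq_ext ts => // i lt.
  by rewrite /upd; case: eqP => // e; move: lt; rewrite e ltnNge nm.
- move=> t C LC; exists (nneg (P (st t))) => // l.
  have [s sC hs] := LC (st t :: l); exists s.
    apply/ev_and; split=> //; apply/ev_neg => h.
    apply: (hs (st t)); first by left.
    by have [_ _] := hP (st t); apply.
  by move=> t' h; apply: hs; right.
- by move=> l; have [s hs] := inf l; exists s => //; apply/ev_neg.
have [|f fi [g fK gK]] := countable_iso pi_surj; first by move=> p /modM; rewrite -ee.
have /choice [h hh] := en_surj.
have [t ht] := code_funP n (h \o g \o pi).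
have [_ -> /ev_neg] := omit t; apply.
have [dP eP _] := hP (st t).
have -> : pi = f \o (g \o pi) by apply/funext => i /=; rewrite gK.
rewrite ev_iso //; apply: (proj1 (dP (st t) _ _)) eP => i lt /=.
by rewrite /st /= ht //= hh.
Qed.

Lemma tpeq_forth n s s' y : tpeq n s s' ->
  exists y', tpeq n.+1 (upd s n y) (upd s' n y').
Proof.
move=> h; have [p [dp ep hp]] := isolated n.+1 (upd s n y).
have dp' : dep M n (nex n p).
  have half u u' : (forall i, i < n -> u i = u' i) ->
      ev (M := M) u (nex n p) -> ev u' (nex n p).
    move=> uu' /ev_ex [x hx]; apply/ev_ex; exists x.
    apply: (proj1 (dp (upd u n x) _ _)) hx => i; rewrite ltnS leq_eqVlt /upd.
    by case: eqP => //= _; apply: uu'.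
  by move=> u u' uu'; split; apply: half => // i /uu'.
have /(h _ dp') /ev_ex [y' hy'] : ev s (nex n p) by apply/ev_ex; exists y.
by exists y'; apply: hp.
Qed.

(** Back and forth along an enumeration of M: [st k] is a pair of assignments
    with the same type below [lvl k], and the limits [S] and [S'] of these
    assignments are onto. *)
Lemma homogeneous n s s' : tpeq n s s' ->
  exists2 g : M -> M, isomorphism g & forall i, i < n -> g (s i) = s' i.
Proof.
move=> ss'; have [en en_surj] := enumM.
pose lvl k := n + k.*2.
have /choice [nxt hnxt] : forall kss : nat * ((nat -> M) * (nat -> M)),
    exists r : (nat -> M) * (nat -> M),
    tpeq (lvl kss.1) kss.2.1 kss.2.2 ->
    [/\ tpeq (lvl kss.1.+1) r.1 r.2,
        forall i, i < lvl kss.1 -> r.1 i = kss.2.1 i /\ r.2 i = kss.2.2 i,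
        r.1 (lvl kss.1) = en kss.1 & r.2 (lvl kss.1).+1 = en kss.1].
  move=> [k [u u']] /=; case: (pselect (tpeq (lvl k) u u')); last by exists (u, u).
  move=> uu'; set m := lvl k in uu' *.
  have [y hy] := tpeq_forth (en k) uu'.
  have [y' hy'] := tpeq_forth (en k) (tpeq_sym hy).
  exists (upd (upd u m (en k)) m.+1 y', upd (upd u' m y) m.+1 (en k)) => _ /=.
  split.
  - by rewrite /lvl doubleS !addnS; apply: tpeq_sym.
  - move=> i lt; rewrite /upd; case: eqP => [e|_].
      by move: lt; rewrite e ltnNge leqnSn.
    by case: eqP => // e; move: lt; rewrite e ltnn.
  - by rewrite /upd (ltn_eqF (ltnSn m)) eqxx.
  - by rewrite /upd eqxx.
pose fix st k := if k is k'.+1 then nxt (k', st k') else (s, s').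
have stP k : tpeq (lvl k) (st k).1 (st k).2.
  elim: k => [|k IHk]; first by rewrite /lvl addn0.
  by have [] := hnxt (k, st k) IHk.
have stS k := hnxt (k, st k) (stP k).
have lvlW k l : k <= l -> lvl k <= lvl l.
  by move=> kl; rewrite leq_add2l leq_double.
have agree k l i : k <= l -> i < lvl k -> (st l).1 i = (st k).1 i /\ (st l).2 i = (st k).2 i.
  move=> /subnKC <- lt; elim: (l - k) => [|d IHd]; first by rewrite addn0.
  rewrite addnS; have [_ h _ _] := stS (k + d).
  have [|-> ->//] := h i; apply: leq_trans lt _; apply: lvlW; exact: leq_addr.
have lt_lvl i : i < lvl i.+1.
  by rewrite /lvl doubleS !addnS ltnS -addnn addnA; apply: leq_trans (leqnSn _); rewrite leq_addl.
pose S i := (st i.+1).1 i; pose S' i := (st i.+1).2 i.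
have SE k i : i < lvl k -> S i = (st k).1 i /\ S' i = (st k).2 i.
  move=> lt; rewrite /S /S'; case: (leqP i.+1 k) => ik.
    by have [-> ->] := agree _ _ _ ik (lt_lvl i).
  by have [-> ->] := agree _ _ _ (ltnW ik) lt.
have SS' p : ev S p <-> ev S' p.
  have [m dm] := ex_dep M p.
  have ltm i : i < m -> i < lvl m.
    by move=> /leq_trans; apply; rewrite /lvl -addnn addnA leq_addl.
  rewrite (dm S (st m).1); last by move=> i /ltm /SE [].
  rewrite (dm S' (st m).2); last by move=> i /ltm /SE [].
  by apply: stP; apply: depW dm; rewrite /lvl -addnn addnA leq_addl.
have S_surj y : exists i, S i = y.
  have [k <-] := en_surj y; exists (lvl k).
  have [_ _ <- _] := stS k.
  by have [] := SE k.+1 (lvl k) _; rewrite // /lvl doubleS !addnS.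
have S'_surj y : exists i, S' i = y.
  have [k <-] := en_surj y; exists (lvl k).+1.
  have [_ _ _ <-] := stS k.
  by have [] := SE k.+1 (lvl k).+1 _; rewrite // /lvl doubleS !addnS.
have S_eq i j : S i = S j <-> S' i = S' j by have := SS' (neq V i j); rewrite !ev_eq.
have /choice [h hh] := S_surj; have /choice [h' hh'] := S'_surj.
exists (S' \o h); last first.
  move=> i lt /=.
  have [|/= <- <-] := SE 0 i; first by rewrite /lvl addn0.
  by apply/S_eq; apply: hh.
split.
  exists (S \o h') => x /=.
    by rewrite -[RHS](hh x); apply/S_eq; apply: hh'.
  by rewrite -[RHS](hh' x); apply/S_eq; apply: hh.
move=> r t.
have := SS' (Nform (Rel (ord_tuple (arity r))) (map_tuple h t)); rewrite /ev /=.
set t1 := map_tuple _ _; set t2 := map_tuple _ _.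
have -> : t1 = t by apply: eq_from_tnth => i; rewrite !tnth_map tnth_ord_tuple /=.
suff -> : t2 = map_tuple (S' \o h) t by [].
by apply: eq_from_tnth => i; rewrite !tnth_map tnth_ord_tuple.
Qed.

End OmegaCategorical.

(** * The automorphism group of the countable model *)

Lemma infinite_inj (T : Type) (A : set T) : infinite_set A ->
  exists2 f : nat -> T, injective f & forall i, A (f i).
Proof.
elim/Ppointed: T => T in A *; first by rewrite emptyE => /infinite_setN0 [].
move=> /infiniteP/ppcard_leP[f]; exists f.
  by move=> i j; apply: inj; rewrite inE.
by move=> i; apply: funS.
Qed.

Lemma nth_In (T : Type) (x0 : T) (s : seq T) i : i < size s ->
  List.In (nth x0 s i) s.
Proof.
elim: s i => //= z s IHs [|i] lt; first by left.
by right; apply: IHs.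
Qed.

Section Oligomorphic.
Local Open Scope classical_set_scope.
Variables (V : vocabulary) (T : set (sentence V)).
Hypothesis hcat : omega_categorical T.
Variable M : structure V.
Hypotheses (modM : model T M) (ctM : countably_infinite M).

Local Notation aut := (@isomorphism V M M).

Lemma aut_id : aut id.
Proof.
split; first by exists id.
by move=> r t; rewrite (_ : map_tuple id t = t) //; apply: val_inj; rewrite /= map_id.
Qed.

Lemma aut_comp g h : aut g -> aut h -> aut (g \o h).
Proof.
move=> [gb gi] [hb hi]; split; first exact: bij_comp.
move=> r t; rewrite hi gi; set u := map_tuple _ _; set w := map_tuple _ _.
by suff -> : u = w by []; apply: eq_from_tnth => i; rewrite !tnth_map.
Qed.

Lemma aut_inv g : aut g -> exists2 h, aut h & cancel g h /\ cancel h g.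
Proof.
move=> [[h gK hK] gi]; exists h => //; split; first by exists g.
move=> r t; rewrite [X in _ <-> X]gi; set u := map_tuple g _.
by suff -> : u = t by []; apply: eq_from_tnth => i; rewrite !tnth_map hK.
Qed.

Let s0 : nat -> M.
Proof. by have /cid [en _] := enumM ctM; exact: en. Qed.
Let asg (a : seq M) : nat -> M := nth (s0 0) a.

Let map_asg a n : size a = n -> map (asg a) (iota 0 n) = a.
Proof.
move=> e; apply: (@eq_from_nth _ (s0 0)); rewrite size_map size_iota // => i lt.
by rewrite (nth_map 0) ?size_iota // nth_iota.
Qed.

(** A colouring whose classes lie in single orbits is the form of finiteness to
    which the pigeonhole principle and Ramsey's theorem apply. *)
Lemma oligomorphic n : exists p (f : seq M -> 'I_p), forall a b,
  size a = n -> size b = n -> f a = f b -> exists2 g, aut g & map g a = b.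
Proof.
have [l hl] := finitely_many_types hcat modM ctM n.
pose d := asg [::].
have /choice [F hF] a : exists i : 'I_(size l), tpeq n (nth d l i) (asg a).
  have [t tl ht] := hl (asg a).
  have [i li e] : exists2 i, i < size l & nth d l i = t.
    elim: l tl {hl} => //= u l IHl [<-|/IHl [i li e]]; first by exists 0.
    by exists i.+1.
  by exists (Ordinal li); rewrite /= e.
exists (size l), F => a b sa sb e.
have h : tpeq n (asg a) (asg b).
  by apply: tpeq_trans (hF b); rewrite -e; apply: tpeq_sym.
have [g ag hg] := homogeneous hcat modM ctM h.
exists g => //; rewrite -(map_asg sa) -(map_asg sb) -map_comp.
by apply/eq_in_map => i; rewrite mem_iota /= => /hg.
Qed.

(** An invariant relation is a union of types, which are isolated and finite in
    number. *)
Lemma invariant_definable m (W : seq M -> Prop) :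
  (forall g a, aut g -> W a -> W (map g a)) ->
  exists phi : formula V m, forall v : m.-tuple M, sat phi v <-> W v.
Proof.
move=> Winv; have [l hl] := finitely_many_types hcat modM ctM m.
have /choice [P hP] := isolated hcat modM ctM m.
pose l' := seq.filter (fun t => `[< W (map t (iota 0 m)) >]) l.
have l'P t : List.In t l' <-> List.In t l /\ W (map t (iota 0 m)).
  rewrite /l'; elim: l {hl l'} => /= [|u l IHl]; first by split=> // -[].
  case: asboolP => Wu /=; rewrite IHl; split.
  - by move=> [<-|[]]; [split=> //; left|split=> //; right].
  - by move=> [[->|tl] Wt]; [left|right].
  - by move=> [? ?]; split=> //; right.
  - by move=> [[<-|]].
pose p := nors (map P l').
have hp s : ev s p <-> W (map s (iota 0 m)).
  rewrite ev_ors; split=> [[_ /List.in_map_iff [t [<- /l'P [tl Wt]]] es]|Ws].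
    have [_ _ /(_ _ es) ts] := hP t.
    have [g ag hg] := homogeneous hcat modM ctM ts.
    have -> : map s (iota 0 m) = map g (map t (iota 0 m)).
      by rewrite -map_comp; apply/eq_in_map => i; rewrite mem_iota /= => /hg.
    exact: Winv.
  have [t tl ts] := hl s; have [dt et _] := hP t.
  exists (P t); last by apply/ts.
  apply: List.in_map; apply/l'P; split=> //.
  have [g ag hg] := homogeneous hcat modM ctM (tpeq_sym ts).
  have -> : map t (iota 0 m) = map g (map s (iota 0 m)).
    by rewrite -map_comp; apply/eq_in_map => i; rewrite mem_iota /= => /hg.
  exact: Winv.
have dp : dep M m p.
  move=> s s' ss'; rewrite !hp.
  suff -> : map s (iota 0 m) = map s' (iota 0 m) by [].
  by apply/eq_in_map => i; rewrite mem_iota /= => /ss'.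
have [phi hphi] := dep_formula dp; exists phi => v.
have e : map (asg v) (iota 0 m) = v by apply: map_asg; rewrite size_tuple.
rewrite -[X in W X]e -hp -hphi; split; apply: sat_eq; by rewrite /= ?e.
Qed.

Lemma aut_map_tuple g n (phi : formula V n) (v w : n.-tuple M) :
  aut g -> map g v = w -> sat phi v -> sat phi w.
Proof. by move=> ag e h; apply: sat_eq (proj1 (sat_iso phi v ag) h). Qed.

Hypothesis htriv : trivial_pregeometry T.

(** The orbit of [y] over [b] is definable over [b], being invariant, and it is
    finite, being contained in [Y]. *)
Lemma acl_orbit (Y : set M) (b : seq M) y : finite_set Y -> Y y ->
  (forall g, aut g -> map g b = b -> Y (g y)) ->
  acl (fun x => List.In x b) y.
Proof.
move=> finY Yy Yinv.
pose W a := exists2 g, aut g & map g (y :: b) = a.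
have Winv g a : aut g -> W a -> W (map g a).
  move=> ag [h ah <-]; exists (g \o h); first exact: aut_comp.
  by rewrite -map_comp.
have [phi hphi] := invariant_definable (1 + size b) Winv.
have hin x : inst phi (in_tuple b) x <-> exists2 g, aut g & map g (y :: b) = thead x :: b.
  rewrite /inst /= hphi; have -> : tval (cat_tuple x (in_tuple b)) = thead x :: b.
    by case: x => -[//|z [|//]] /= sz.
  by [].
exists (size b), phi, (in_tuple b); split.
- by move=> i; rewrite (tnth_nth y); apply: nth_In.
- by apply/hin; exists id; [apply: aut_id|rewrite map_id].
- apply: sub_finite_set (finite_image (fun z => [tuple z]) finY) => x /hin [g ag [e1 e2]].
  exists (g y); first exact: Yinv.
  by rewrite e1 [RHS]tuple_eta; apply: val_inj; rewrite /= [x]tuple_eta; case: x {e1} => -[|? []].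
Qed.

Lemma acl_finite_orbits (Y : set M) (b : seq M) : finite_set Y ->
  (forall g, aut g -> map g b = b -> forall y, Y y -> Y (g y)) ->
  forall y, Y y -> List.In y b \/ acl (M := M) set0 y.
Proof.
move=> finY Yinv y Yy.
have := acl_orbit finY Yy (fun g ag e => Yinv g ag e y Yy).
by rewrite (htriv _ modM).
Qed.

Lemma inst0_inv m (phi : formula V (1 + m)) (b : m.-tuple M) g x :
  aut g -> tuple_in set0 b -> inst phi b [tuple x] -> inst phi b [tuple g x].
Proof.
move=> ag b0; apply: (aut_map_tuple ag).
rewrite /=; congr cons; apply: (@eq_from_nth _ x); first by rewrite size_map.
move=> i; rewrite size_map size_tuple => lt.
by case: (b0 (Ordinal lt)).
Qed.

Lemma acl0_inv g x : aut g -> acl (M := M) set0 x -> acl (M := M) set0 (g x).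
Proof.
move=> ag [m [phi [b [b0 hx fin]]]]; exists m, phi, b; split=> //.
exact: inst0_inv.
Qed.

Lemma acl0_finite : finite_set (acl (M := M) set0).
Proof.
have [p [f hf]] := oligomorphic 1.
pose Z c := [set x | acl (M := M) set0 x /\ f [:: x] = c].
have -> : acl (M := M) set0 = \bigcup_(c in [set: 'I_p]) Z c.
  by apply/seteqP; split=> [x hx|x [c _ []]//]; exists (f [:: x]).
apply: bigcup_finite => // c _.
case: (pselect (exists x, Z c x)) => [[x [[m [phi [b [b0 hx fin]]]] fx]]|nZ]; last first.
  suff -> : Z c = set0 by []; apply/seteqP; split=> // x hx; by apply: nZ; exists x.
apply: sub_finite_set (finite_image (fun w : 1.-tuple M => thead w) fin) => y [_ fy].
have [|||g ag [<-]] := hf [:: x] [:: y] => //; first by rewrite fx.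
by exists [tuple g x]; [apply: inst0_inv|].
Qed.

Lemma elementary_id : elementary (@id M).
Proof. by move=> n phi v; split; apply: sat_eq; rewrite /= map_id. Qed.

Lemma map_tuple_id n (v : n.-tuple M) : map_tuple id v = v.
Proof. by apply: val_inj; rewrite /= map_id. Qed.

Lemma same_type_aut (A : set M) g n (a b : n.-tuple M) : aut g ->
  (forall x, A x -> g x = x) -> map g a = b -> same_type A b a.
Proof.
move=> ag gA e m phi c Ac.
have ec : map g c = c.
  apply: (@eq_from_nth _ (s0 0)); first by rewrite size_map.
  move=> i; rewrite size_map size_tuple => lt.
  rewrite (nth_map (s0 0)) ?size_tuple // -(tnth_nth (s0 0) c (Ordinal lt)).
  exact: gA (Ac _).
rewrite /inst [X in _ <-> X](sat_iso _ _ ag).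
by split; apply: sat_eq; rewrite /= map_cat e ec.
Qed.

Hypothesis hSU : forall (a : 1.-tuple M), ~ SU_ge 2 set0 a.

(** By triviality [x] is not algebraic over [b], so it has infinitely many
    conjugates over [b], and the formula [x = y] divides over [b]. *)
Lemma SU_ge1 (b : seq M) x :
  ~ List.In x b -> ~ acl (M := M) set0 x ->
  SU_ge 1 (fun y => List.In y b) [tuple x].
Proof.
move=> xb x0.
pose O := [set y | exists2 g, aut g & map g b = b /\ g x = y].
have infO : infinite_set O.
  move=> finO; have [||//|//] := acl_finite_orbits (Y := O) (b := b) finO _ (y := x).
    move=> g ag gb _ [h ah [hb <-]]; exists (g \o h); first exact: aut_comp.
    by rewrite map_comp hb.
  by exists id; [apply: aut_id|rewrite map_id].
have [h hinj hO] := infinite_inj infO.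
pose A : set M := fun y => List.In y b.
pose phi : formula V (1 + 1) := Eqn V (ord0 : 'I_2) (lift ord0 ord0).
have instE (y z : 1.-tuple M) : inst phi z y <-> thead y = thead z.
  case/tupleP: y => y ?; case/tupleP: z => z ?.
  by rewrite /inst /= !(tnth_nth (s0 0)) /= (tuple0 _).
exists M, id, (A `|` [set x]), [tuple x]; split=> //.
- exact: elementary_id.
- by move=> _ [y Ay <-]; left.
- by rewrite map_tuple_id.
exists 1, phi, [tuple x]; split.
- by move=> i; right; rewrite (tnth_nth x); case: i => -[].
- exact/instE.
exists M, id, 1, (fun=> 1), (fun=> phi), (fun=> [tuple x]); split.
- exact: elementary_id.
- by rewrite map_tuple_id => y hy; exists ord0.
move=> _; exists M, id, 2, (fun i => [tuple h i]); split.
- exact: elementary_id.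
- move=> i; have [g ag [gb gx]] := hO i.
  rewrite map_tuple_id; apply: (same_type_aut ag); last by rewrite /= gx.
  move=> _ [_ [_ [y yb <-] <-] <-] /=.
  have {}yb : List.In y b by exact: yb.
  elim: b gb yb {xb O infO hinj hO A gx h} => //= z b' IHb [e1 e2] []; first by move=> <-.
  exact: IHb.
- move=> s sinj [y hy].
  have /instE e0 := hy ord0; have /instE := hy (lift ord0 ord0).
  by rewrite e0 /= => /hinj/sinj.
Qed.

(** The S1 property. If the conjugates of [W(., b 0)] were [k]-inconsistent, then
    the type over [b 0] of any of its points would fork over the empty set; a
    point outside acl([b 0]) would still have rank at least 1 over [b 0] by
    [SU_ge1], and thus rank at least 2 over the empty set. *)
Theorem consistent_along_orbit (W : M -> seq M -> Prop) (b : nat -> seq M) k :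
  (forall g x a, aut g -> W x a -> W (g x) (map g a)) ->
  (forall i, exists2 g, aut g & map g (b 0) = b i) ->
  infinite_set [set x | W x (b 0)] ->
  exists2 s : 'I_k -> nat, injective s & exists x, forall i, W x (b (s i)).
Proof.
move=> Winv borb infW; apply: contrapT => nW.
pose m := size (b 0).
have sb i : size (b i) == m by have [g _ <-] := borb i; rewrite size_map.
pose bt i : m.-tuple M := Tuple (sb i).
pose W' a := if a is x :: c then W x c else False.
have W'inv g a : aut g -> W' a -> W' (map g a).
  by case: a => //= x c ag; apply: Winv.
have [phi hphi] := invariant_definable (1 + m) W'inv.
have instE x i : inst phi (bt i) x <-> W (thead x) (b i).
  by case/tupleP: x => x t; rewrite /inst /= hphi /= (tuple0 t).
have [x [Wx nx]] : exists x, W x (b 0) /\ ~ acl (fun y => List.In y (b 0)) x.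
  apply: contrapT => /forallNP h; apply: infW.
  apply: (sub_finite_set (B := [set y | List.In y (b 0)] `|` acl (M := M) set0)).
    move=> y Wy; have := h y; rewrite (htriv _ modM) => h'.
    by apply: contrapT => n; apply: h'.
  rewrite finite_setU; split; last exact: acl0_finite.
  elim: (b 0) => [|z l IHl]; first by rewrite (_ : mkset _ = set0).
  apply: (sub_finite_set (B := [set z] `|` [set y | List.In y l])).
    by move=> y [->|]; [left|right].
  by rewrite finite_setU; split.
move: nx; rewrite (htriv _ modM) => /not_orP [nb n0].
apply: (hSU (a := [tuple x])).
exists M, id, (fun y => List.In y (b 0)), [tuple x]; split=> //.
- exact: elementary_id.
- by move=> _ [y [] _].
- by rewrite map_tuple_id.
- exists m, phi, (bt 0); split.
  + by move=> i; rewrite (tnth_nth x); apply: nth_In; rewrite /= (eqP (sb 0)).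
  + exact/instE.
  exists M, id, 1, (fun=> m), (fun=> phi), (fun=> bt 0); split.
  + exact: elementary_id.
  + by rewrite map_tuple_id => y hy; exists ord0.
  move=> _; exists M, id, k, bt; split.
  + exact: elementary_id.
  + move=> i; rewrite map_tuple_id; have [g ag e] := borb i.
    by apply: (same_type_aut ag) => // y [_ [_ [_ [] _] _] _].
  + move=> s sinj [y hy]; apply: nW; exists s => //.
    by exists (thead y) => i; apply/instE.
- exact: SU_ge1.
Qed.

End Oligomorphic.

(** * Ramsey's theorem *)

Definition increasing (h : nat -> nat) := forall i j, i < j -> h i < h j.

Lemma increasingS h : (forall i, h i < h i.+1) -> increasing h.
Proof.
move=> H i; elim=> // j IHj; rewrite ltnS leq_eqVlt => /orP [/eqP ->//|/IHj].
by move=> /ltn_trans; apply.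
Qed.

Lemma increasing_ge h : increasing h -> forall i, i <= h i.
Proof. by move=> H; elim=> // i IHi; apply: leq_ltn_trans (H i i.+1 _). Qed.

Lemma increasing_inj h : increasing h -> injective h.
Proof.
by move=> H i j e; case: (ltngtP i j) => // /H; rewrite e ltnn.
Qed.

Lemma pigeonhole (C : finType) (f : nat -> C) :
  exists2 h, increasing h & exists c, forall i, f (h i) = c.
Proof.
have [c hc] : exists c, forall n, exists2 m, n <= m & f m = c.
  apply: contrapT => /forallNP H.
  have {}H c : exists n, forall m, n <= m -> f m <> c.
    move: (H c) => /existsNP [n hn]; exists n => m nm e; apply: hn.
    by exists m.
  have [b hb] := choice H.
  by apply: (hb (f (\max_c b c)) (\max_c b c)) => //; apply: leq_bigmax.
have [g g1 g2] : exists2 g, (forall n, n <= g n) & forall n, f (g n) = c.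
  have /choice [g hg] : forall n, exists m, n <= m /\ f m = c.
    by move=> n; have [m] := hc n; exists m.
  by exists g => n; case: (hg n).
exists (fun i => iter i (fun n => g n.+1) (g 0)).
  by apply: increasingS => i /=; apply: g1.
by exists c; case=> [|i] /=; apply: g2.
Qed.

(** The iterated reindexings [H k] make the colour of an increasing tuple that
    starts with [H k 0] depend on [k] only; the pigeonhole principle then makes
    it constant. *)
Theorem ramsey (C : finType) (K : nat) (chi : seq nat -> C) :
  exists2 h, increasing h &
    exists c, forall s, size s = K -> sorted ltn s -> chi (map h s) = c.
Proof.
elim: K chi => [|K IHK] chi.
  by exists id => //; exists (chi [::]) => -[].
(* One step: homogenize the colouring induced by the least element of H. *)
have step (H : nat -> nat) : exists H' : nat -> nat, increasing H ->
    [/\ increasing H', exists c, forall s, size s = K -> sorted ltn s ->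
         chi (H 0 :: map H' s) = c & forall i, exists2 j, 0 < j & H' i = H j].
  have [h hi [c hc]] := IHK (fun s => chi (H 0 :: map (H \o S) s)).
  exists (H \o S \o h) => incH; split.
  - by move=> i j ij; apply: incH; apply: hi.
  - exists c => s ss so; rewrite -(hc s) //.
    by rewrite -map_comp.
  - by move=> i; exists (h i).+1.
have [nxt hn] := choice step.
pose H k := iter k nxt id.
have incH k : increasing (H k).
  by elim: k => // k IHk; have [] := hn (H k) IHk.
have /choice [col hcol] k : exists c, forall s, size s = K -> sorted ltn s ->
    chi (H k 0 :: map (H k.+1) s) = c.
  by have [_ ? _] := hn (H k) (incH k).
have sub k l i : k <= l -> exists j, H l i = H k j.
  move=> /subnKC <-; elim: (l - k) i => [|d IHd] i.
    by rewrite addn0; exists i.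
  have [_ _ /(_ i) [j _ e]] := hn (H (k + d)) (incH _).
  by rewrite addnS [H _.+1 i]e.
have subS k l : k < l -> exists j, H l 0 = H k.+1 j by apply: sub.
have inca : increasing (fun k => H k 0).
  apply: increasingS => k; have [_ _ /(_ 0) [j j0 e]] := hn (H k) (incH k).
  by rewrite [H k.+1 0]e; apply: incH.
have [g incg [c hc]] := pigeonhole col.
exists (fun k => H (g k) 0); first by move=> i j ij; apply: inca; apply: incg.
exists c => -[//|x s] /= [ss] so.
have /choice [j hj] : forall y, exists j, x < y -> H (g y) 0 = H (g x).+1 j.
  move=> y; case: (ltnP x y) => [xy|]; last by exists 0.
  by have [j ->] := subS _ _ (incg _ _ xy); exists j.
have lex : all (ltn x) s by apply: order_path_min so => //; apply: ltn_trans.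
have -> : [seq H (g k) 0 | k <- s] = map (H (g x).+1) (map j s).
  rewrite -map_comp; apply/eq_in_map => y ys /=; apply: hj.
  exact: (allP lex).
rewrite hcol ?size_map //.
have so' := path_sorted so.
rewrite sorted_map; apply: (sub_in_sorted (P := ltn x) (e := ltn)) so' => //.
move=> y z xy xz yz /=.
rewrite ltnNge; apply/negP => le.
have := inca _ _ (incg _ _ yz); rewrite /= hj // hj // ltnNge => /negP; apply.
move: le; rewrite leq_eqVlt => /orP [/eqP ->//|lt].
exact: ltnW (incH _ _ _ lt).
Qed.

(** * Random labellings *)

Lemma exp_beats_poly D q B : exists s, B * (q + s) ^ q * D ^ s < D.+1 ^ s.
Proof.
case: D => [|D]; first by exists 1; rewrite muln0 exp1n.
(* With s = t (q + 1), Bernoulli gives (d + 1)^s / d^s >= (t / d)^(q + 1). *)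
set d := D.+1; pose t := (B * (q + q.+1) ^ q * d ^ q.+1).+1.
have bern k : k * d ^ k <= d * d.+1 ^ k.
  elim: k => // k IHk; rewrite !expnS.
  have h : d ^ k <= d.+1 ^ k by case: (k) => // k'; rewrite leq_exp2r.
  nia.
exists (t * q.+1).
have dpos : 0 < d ^ q.+1 by rewrite expn_gt0.
rewrite -(ltn_pmul2l dpos).
have h1 : t ^ q.+1 * d ^ (t * q.+1) <= d ^ q.+1 * d.+1 ^ (t * q.+1).
  by rewrite !expnM -!expnMn leq_exp2r.
apply: leq_trans h1.
rewrite mulnA ltn_pmul2r ?expn_gt0 //.
have h2 : (q + t * q.+1) ^ q <= (q + q.+1) ^ q * t ^ q.
  have le1 a b c : 0 < c -> a + c * b <= (a + b) * c.
    by move=> c0; rewrite mulnDl (mulnC c b) leq_add2r leq_pmulr.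
  by rewrite -expnMn; case: (q) => // q'; rewrite leq_exp2r //; apply: le1.
rewrite [t ^ q.+1]expnSr.
apply: (@leq_ltn_trans (t ^ q * (B * (q + q.+1) ^ q * d ^ q.+1))).
  apply: leq_trans (leq_mul (leqnn _) (leq_mul (leqnn _) h2)) _.
  move: (d ^ q.+1) (t ^ q) ((q + q.+1) ^ q) => x y z.
  by rewrite mulnC [X in _ <= X]mulnC -!mulnA (mulnC y x).
by rewrite ltn_pmul2l ?expn_gt0 // /t ltnS.
Qed.

Section Extension.
Variables (C L : finType) (l0 : L) (q m : nat).
Local Notation U := (C * 'I_m)%type.
Local Notation Omega := {ffun U * U -> L}.

Definition prec (u v : U) : bool := enum_rank u < enum_rank v.
(** A labelling is only consulted at pairs in increasing order of rank: labels
    are not symmetric, so each pair of vertices is given one label, in a fixed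
    orientation. *)
Definition edge (u v : U) : U * U := if prec u v then (u, v) else (v, u).

Section Requirement.
Variables (w : q.-tuple U) (z1 z2 : U -> L).

Definition hit (f : Omega) (u : U) : bool :=
  all (fun v => f (edge u v) == if prec u v then z1 v else z2 v) w.

Definition reset (u : U) (f : Omega) : Omega := [ffun c : U * U =>
  if [&& c.1 == u, c.2 \in w & prec u c.2] then z1 c.2
  else if [&& c.2 == u, c.1 \in w & ~~ prec u c.1] then z2 c.1 else f c].

Lemma hit_reset u f : u \notin w -> hit (reset u f) u.
Proof.
move=> uw; apply/allP => v vw; rewrite /edge /reset.
have vu : v != u by apply: contraNneq uw => <-.
by case: ifP => p; rewrite ffunE /= ?(negPf vu) ?eqxx ?vw ?p.
Qed.

Lemma hit_reset_other u u' f : u \notin w -> u' \notin w -> u' != u ->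
  hit (reset u f) u' = hit f u'.
Proof.
move=> uw u'w u'u; apply: eq_in_all => v vw; rewrite /edge /reset.
have vu : v != u by apply: contraNneq uw => <-.
by case: ifP => p; rewrite ffunE /= ?(negPf vu) ?(negPf u'u).
Qed.

Lemma reset_inj u f f' : u \notin w -> reset u f = reset u f' ->
  (forall v, v \in w -> f (edge u v) = f' (edge u v)) -> f = f'.
Proof.
move=> uw e h; apply/ffunP => -[c d].
have := congr1 (fun g : Omega => g (c, d)) e; rewrite !ffunE /=.
case: ifP => [/and3P [/eqP -> dw p] _|_].
  by have := h d dw; rewrite /edge p.
case: ifP => [/and3P [/eqP -> cw p] _|//].
by have := h c cw; rewrite /edge (negPf p).
Qed.

Variable g : C.

Definition bad (J : seq 'I_m) : {set Omega} :=
  [set f | all (fun j => ~~ hit f (g, j)) J].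

(** Under the counting measure each [(g, j)] hits with probability at least
    [#|L| ^ -q], independently of the others: resetting the edges between
    [(g, j)] and [w] turns every labelling into one that hits, does not affect
    the other vertices, and merges at most [#|L| ^ q] labellings. *)
Lemma card_bad (J : seq 'I_m) : uniq J -> {in J, forall j, (g, j) \notin w} ->
  (#|L| ^ q) ^ size J * #|bad J| <= (#|L| ^ q).-1 ^ size J * #|{: Omega}|.
Proof.
set A := #|L| ^ q.
have A0 : 0 < A by rewrite expn_gt0; apply/orP; left; apply/card_gt0P; exists l0.
elim: J => [|j J IHJ] /=; first by rewrite !mul1n max_card.
move=> /andP [jJ uJ] Jw.
have jw : (g, j) \notin w by apply: Jw; rewrite inE eqxx.
have {}Jw : {in J, forall j, (g, j) \notin w} by move=> i iJ; apply: Jw; rewrite inE iJ orbT.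
have {}IHJ := IHJ uJ Jw.
pose H := bad J :&: [set f | hit f (g, j)].
have splitB : #|bad J| = #|H| + #|bad (j :: J)|.
  rewrite -(cardsID [set f | hit f (g, j)]); congr addn.
  by apply: eq_card => f; rewrite !inE.
have cover : #|bad J| <= A * #|H|.
  pose F f := (reset (g, j) f, [tuple f (edge (g, j) (tnth w i)) | i < q]).
  have Finj : injective F.
    move=> f f' e; apply: (reset_inj jw (congr1 fst e)) => v /tnthP [i ->].
    by have := congr1 (fun x => tnth x.2 i) e; rewrite /F /= !tnth_mktuple.
  rewrite -(card_imset (bad J) Finj).
  have -> : A * #|H| = #|finset.setX H [set: q.-tuple L]|.
    by rewrite cardsX cardsT card_tuple mulnC.
  apply: subset_leq_card; apply/fintype.subsetP => _ /imsetP [f fB ->].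
  rewrite !inE hit_reset // !andbT; move: fB; rewrite inE => /allP fB.
  apply/allP => i iJ; rewrite hit_reset_other //; first exact: fB.
    exact: Jw.
  by apply: contraNneq jJ => -[<-].
have step : A * #|bad (j :: J)| <= A.-1 * #|bad J| by rewrite splitB in cover *; nia.
rewrite !expnS (mulnC A) -!mulnA; apply: leq_trans (leq_mul (leqnn _) IHJ).
by rewrite [X in _ <= X]mulnCA; apply: leq_mul.
Qed.

End Requirement.
End Extension.

(** The requirements [(w, g, z1, z2)] are polynomially many in [m], and by
    [card_bad] the proportion of labellings that fail a given one is
    exponentially small in [m]. Hence some labelling fails none. *)
Theorem generic_extension (C L : finType) (l0 : L) (q : nat) :
  exists m (f : {ffun (C * 'I_m) * (C * 'I_m) -> L}),
  forall (w : seq (C * 'I_m)) (g : C) (z1 z2 : C * 'I_m -> L), size w <= q ->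
  exists2 j, (g, j) \notin w & forall v, v \in w ->
    f (edge (g, j) v) = if prec (g, j) v then z1 v else z2 v.
Proof.
pose A := #|L| ^ q.
have A0 : 0 < A by rewrite expn_gt0; apply/orP; left; apply/card_gt0P; exists l0.
have [s hs] := exp_beats_poly A.-1 q (#|C| ^ q * #|L| ^ q * #|L| ^ q * #|C|).
rewrite (prednK A0) in hs.
pose m := q + s; exists m.
pose U := (C * 'I_m)%type; pose Om := {ffun U * U -> L}.
pose Rq := (q.-tuple U * q.-tuple L * q.-tuple L * C)%type.
pose val_of (w : q.-tuple U) (c : q.-tuple L) v := nth l0 c (index v w).
pose J (r : Rq) := [seq j <- enum 'I_m | (r.2, j) \notin r.1.1.1].
pose B (r : Rq) : {set Om} :=
  bad r.1.1.1 (val_of r.1.1.1 r.1.1.2) (val_of r.1.1.1 r.1.2) r.2 (J r).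
have cRq : #|{: Rq}| = #|C| ^ q * #|L| ^ q * #|L| ^ q * #|C| * m ^ q.
  rewrite !card_prod !card_tuple card_prod card_ord expnMn.
  by move: (#|C| ^ q) (#|L| ^ q) (m ^ q) #|C| => *; nia.
have Om0 : 0 < #|{: Om}| by apply/card_gt0P; exists [ffun=> l0].
have small r : #|{: Rq}| * #|B r| < #|{: Om}|.
  have sJ : s <= size (J r).
    pose a j := (r.2, j) \in r.1.1.1.
    have e := count_predC a (enum 'I_m); rewrite size_enum_ord in e.
    have -> : size (J r) = count (predC a) (enum 'I_m) by rewrite size_filter.
    suff h : count a (enum 'I_m) <= q.
      rewrite -(leq_add2l q).
      apply: (@leq_trans (count a (enum 'I_m) + count (predC a) (enum 'I_m))).
        by rewrite e.
      by rewrite leq_add2r.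
    rewrite -size_filter -[X in _ <= X](size_tuple r.1.1.1).
    rewrite -(size_map (fun j => (r.2, j))).
    apply: uniq_leq_size.
      rewrite map_inj_uniq; last by move=> ? ? [].
      by rewrite filter_uniq // enum_uniq.
    by move=> _ /mapP [j + ->]; rewrite mem_filter => /andP [].
  have cb : A ^ size (J r) * #|B r| <= A.-1 ^ size (J r) * #|{: Om}|.
    apply: card_bad => //; first by rewrite filter_uniq // enum_uniq.
    by move=> j; rewrite mem_filter => /andP [].
  have hJ : #|{: Rq}| * A.-1 ^ size (J r) < A ^ size (J r).
    rewrite -(subnKC sJ) !expnD.
    have h1 : A.-1 ^ (size (J r) - s) <= A ^ (size (J r) - s).
      by case: (_ - _) => // k; rewrite leq_exp2r // leq_pred.
    have h2 : 0 < A ^ (size (J r) - s) by rewrite expn_gt0 A0.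
    move: hs; rewrite -cRq.
    move: (A ^ _) (A.-1 ^ _) (A ^ s) (A.-1 ^ s) #|{: Rq}| h1 h2 => a b c d k h1 h2 h3.
    by nia.
  have h2 : 0 < A ^ (size (J r)) by rewrite expn_gt0 A0.
  rewrite -(ltn_pmul2l h2).
  move: (A ^ _) (A.-1 ^ _) #|{: Rq}| #|B r| #|{: Om}| hJ cb h2 Om0 => a b k x o.
  by nia.
have [f fB] : exists f : Om, forall r, f \notin B r.
  have lt : #|\bigcup_r B r| < #|{: Om}|.
    have le : #|\bigcup_r B r| <= \sum_r #|B r|.
      apply: (big_ind2 (fun (X : {set Om}) n => #|X| <= n)) => // [|X n Y n' h h'].
        by rewrite cards0.
      by apply: leq_trans (leq_card_setU _ _) (leq_add h h').
    apply: leq_ltn_trans le _.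
    case: (posnP #|{: Rq}|) => [e0|K0].
      by rewrite big_pred0 // => r; have := fintype0 r; rewrite e0.
    rewrite -(ltn_pmul2l K0) big_distrr /=.
    rewrite -sum_nat_const.
    have [r0 _] : exists r0 : Rq, true by move/card_gt0P: K0 => [r0 _]; exists r0.
    rewrite (bigD1 r0) //= [X in _ < X](bigD1 r0) //= -addSn.
    by apply: leq_add => //; apply: leq_sum => r _; apply: ltnW.
  have /existsP [f hf] : [exists f, f \notin \bigcup_r B r].
    apply: contraLR lt; rewrite negb_exists => /forallP h.
    rewrite -leqNgt -cardsT; apply: subset_leq_card; apply/fintype.subsetP => f _.
    by have := h f; rewrite negbK.
  exists f => r; apply: contra hf => fr; by apply/bigcupP; exists r.
exists f => w g z1 z2 sw.
case: (posnP m) => [m0|mpos].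
  have q0 : q = 0 by move: m0; rewrite /m; lia.
  have s0 : s = 0 by move: m0; rewrite /m; lia.
  have : 0 < #|C| by apply/card_gt0P; exists g.
  by move: hs; rewrite q0 s0 !expn0 /= !muln1 !mul1n; case: #|C|.
(* Shorter w are padded to length q. *)
pose u0 : U := (g, Ordinal mpos).
have sw' : size (w ++ nseq (q - size w) u0) == q by rewrite size_cat size_nseq subnKC.
pose wt := Tuple sw'.
pose r : Rq := (wt, map_tuple z1 wt, map_tuple z2 wt, g).
have := fB r; rewrite inE -has_predC => /hasP [j].
rewrite mem_filter /= negbK => /andP [jw _] /allP hj.
exists j => [|v vw]; first by move: jw; rewrite mem_cat negb_or => /andP [].
have vwt : v \in wt by rewrite mem_cat vw.
have vo z : val_of wt (map_tuple z wt) v = z v.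
  by rewrite /val_of /= (nth_map u0) ?index_mem // nth_index.
by have /eqP -> := hj v vwt; rewrite !vo.
Qed.

(** * Relations of finite index *)

Section FiniteIndex.
Local Open Scope classical_set_scope.
Variable M : choiceType.

Definition fin_index (E : M -> M -> Prop) : Prop :=
  exists p (f : M -> 'I_p), forall x y, f x = f y -> E x y.

Lemma fin_indexF (C : finType) (f : M -> C) (E : M -> M -> Prop) :
  (forall x y, f x = f y -> E x y) -> fin_index E.
Proof.
by move=> h; exists #|C|, (enum_rank \o f) => x y /enum_rank_inj; apply: h.
Qed.

Lemma fin_index_all (I : finType) (E : I -> M -> M -> Prop) :
  (forall i, fin_index (E i)) -> fin_index (fun x y => forall i, E i x y).
Proof.
move=> /choice [p h].
have {}h : exists f : forall i, M -> 'I_(p i), forall i x y, f i x = f i y -> E i x y.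
  by exists (fun i => projT1 (cid (h i))) => i; case: cid.
have [f hf] := h.
apply: (@fin_indexF {dffun forall i : I, 'I_(p i)} (fun x => [ffun i => f i x])).
by move=> x y /ffunP e i; apply: hf; have := e i; rewrite !ffunE.
Qed.

Lemma fin_index_reps (E : M -> M -> Prop) : fin_index E ->
  exists r : seq M, forall x, exists2 y, y \in r & E x y.
Proof.
move=> [p [f hf]].
case: (pselect (exists x : M, True)) => [[x0 _]|nM]; last first.
  by exists [::] => x; case: nM; exists x.
have /choice [h hh] : forall c, exists x, forall y, f y = c -> f x = c.
  move=> c; case: (pselect (exists y, f y = c)) => [[y e]|n]; first by exists y.
  by exists x0 => y e; case: n; exists y.
exists (map h (enum 'I_p)) => x; exists (h (f x)).
  by apply: map_f; rewrite mem_enum.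
by apply: hf; rewrite (hh (f x) x).
Qed.

(** Choosing unrelated elements greedily either goes on forever or ends with a
    finite set of representatives. *)
Lemma infinite_antichain (X : eqType) (P : X -> Prop) (S : X -> X -> Prop) :
  (forall x, S x x) -> (forall x y, S x y -> S y x) ->
  (forall x y z, S x y -> S y z -> S x z) ->
  (exists p (f : X -> 'I_p), forall x y, P x -> P y -> f x = f y -> S x y) \/
  (exists2 al : nat -> X, (forall i, P (al i)) &
     forall i j, i < j -> ~ S (al i) (al j)).
Proof.
move=> Sr Ss St.
case: (pselect (exists l : seq X, forall x, P x -> exists2 y, y \in l & S y x)).
  move=> [l hl]; left.
  have /choice [f hf] : forall x, exists i : 'I_(size l).+1, P x ->
      i < size l /\ S (nth x l i) x.
    move=> x; case: (pselect (P x)) => [/hl [y yl Sy]|nP]; last by exists ord0.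
    have lt : index y l < (size l).+1 by rewrite ltnS index_size.
    by exists (Ordinal lt) => _; rewrite /= index_mem nth_index.
  exists (size l).+1, f => x y Px Py e.
  have [lx hx] := hf x Px; have [ly hy] := hf y Py; rewrite -e in hy.
  rewrite (set_nth_default x) // in hy.
  exact: St (Ss _ _ hx) hy.
move=> h; right.
have /choice [nx hnx] : forall l : seq X, exists x, P x /\ forall y, y \in l -> ~ S y x.
  move=> l; apply: contrapT => n; apply: h; exists l => x Px.
  apply: contrapT => n'; apply: n; exists x; split=> // y yl Sy.
  by apply: n'; exists y.
pose fix ls k := if k is k'.+1 then rcons (ls k') (nx (ls k')) else [::].
exists (fun k => nx (ls k)) => [i|i j ij]; first by have [] := hnx (ls i).
have [_] := hnx (ls j); apply.
elim: j ij => // j IHj; rewrite ltnS leq_eqVlt /= mem_rcons inE.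
by case/orP => [/eqP ->|/IHj ->]; rewrite ?eqxx ?orbT.
Qed.

End FiniteIndex.

(** * Oligomorphic groups with trivial closure and S1 *)

Section PermutationGroup.
Local Open Scope classical_set_scope.
Variable M : choiceType.
Variables (G : (M -> M) -> Prop) (A0 : set M).
Hypotheses (G_id : G id) (G_comp : forall g h, G g -> G h -> G (g \o h))
  (G_inv : forall g, G g -> exists2 h, G h & cancel g h /\ cancel h g).
Hypothesis G_oligo : forall n, exists p (f : seq M -> 'I_p), forall a b,
  size a = n -> size b = n -> f a = f b -> exists2 g, G g & map g a = b.
Hypothesis G_acl : forall (Y : set M) (b : seq M), finite_set Y ->
  (forall g, G g -> map g b = b -> forall y, Y y -> Y (g y)) ->
  forall y, Y y -> y \in b \/ A0 y.
Hypotheses (A0_fin : finite_set A0) (A0_inv : forall g x, G g -> A0 x -> A0 (g x)).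
Hypothesis G_S1 : forall (W : M -> seq M -> Prop) (b : nat -> seq M) k,
  (forall g x a, G g -> W x a -> W (g x) (map g a)) ->
  (forall i, exists2 g, G g & map g (b 0) = b i) ->
  infinite_set [set x | W x (b 0)] ->
  exists2 s : 'I_k -> nat, injective s & exists x, forall i, W x (b (s i)).

Lemma map_fix (g : M -> M) (s : seq M) x : map g s = s -> x \in s -> g x = x.
Proof.
elim: s => //= y s IHs [e1 e2]; rewrite inE => /orP [/eqP ->//|]; exact: IHs.
Qed.

(** By the pigeonhole principle the parameters may be assumed to lie in a single
    orbit over [r], to which S1 applies. *)
Lemma S1_params (W : M -> seq M -> Prop) (r : seq M) m (b : nat -> seq M) k :
  (forall g x a, G g -> map g r = r -> W x a -> W (g x) (map g a)) ->
  (forall i, size (b i) = m) ->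
  (forall i, infinite_set [set x | W x (b i)]) ->
  exists2 s : 'I_k -> nat, injective s & exists x, forall i, W x (b (s i)).
Proof.
move=> Winv bm binf.
have [p [f hf]] := G_oligo (m + size r).
have [h inch [c hc]] := pigeonhole (fun i => f (b i ++ r)).
pose W' x c := exists g a y, [/\ G g, size a = m, c = map g (a ++ r), x = g y & W y a].
have W'E x i : W' x (b i ++ r) <-> W x (b i).
  split=> [[g [a [y [Gg sa e -> Wy]]]]|Wx]; last first.
    by exists id, (b i), x; rewrite map_id.
  move: e; rewrite map_cat => /eqP; rewrite eqseq_cat; last by rewrite bm size_map.
  by move=> /andP [/eqP -> /eqP e]; apply: Winv.
have [||| s sinj [x hx]] := @G_S1 W' (fun i => b (h i) ++ r) k.
- move=> g x a Gg [g' [a' [y [Gg' sa -> -> Wy]]]].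
  exists (g \o g'), a', y; split=> //; first exact: G_comp.
  by rewrite -map_comp.
- by move=> i; apply: hf; rewrite ?size_cat ?bm // !hc.
- by move=> fin; apply: (binf (h 0)); apply: sub_finite_set fin => x /W'E.
exists (h \o s).
  exact: inj_comp (increasing_inj inch) sinj.
by exists x => i; apply/W'E; apply: hx.
Qed.

(** Koenig's lemma: up to the action of the stabilizer of [r], a tuple of tuples
    has finitely many one-step extensions. *)
Lemma konig (Q : seq (seq M) -> Prop) m (r : seq M) :
  (forall g t, G g -> map g r = r -> Q t -> Q (map (map g) t)) ->
  (forall t k, Q t -> Q (take k t)) ->
  (forall t a, Q t -> a \in t -> size a = m) ->
  (forall N, exists2 t, Q t & N <= size t) ->
  exists b : nat -> seq M, forall n, Q (mkseq b n).
Proof.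
move=> Qinv Qtake Qsize Qlong.
pose ext s := forall N, exists t, [/\ Q t, N <= size t & take (size s) t = s].
have step s : ext s -> exists x, ext (rcons s x).
  move=> /choice [t ht].
  pose n := size s; pose x N := nth [::] (t (N + n.+1)) n.
  have [p [f hf]] := G_oligo (size (flatten s) + (m + size r)).
  have [h inch [c hc]] := pigeonhole (fun N => f (flatten s ++ (x N ++ r))).
  have xm N : size (x N) = m.
    have [Qt Nt _] := ht (N + n.+1); apply: (Qsize _ _ Qt); apply: mem_nth.
    by apply: leq_trans Nt; rewrite leq_addl.
  exists (x (h 0)) => N.
  have [|||g Gg e] := hf (flatten s ++ (x (h N) ++ r)) (flatten s ++ (x (h 0) ++ r)).
  - by rewrite !size_cat xm.
  - by rewrite !size_cat xm.
  - by rewrite !hc.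
  have [Qt Nt te] := ht (h N + n.+1).
  move: e; rewrite !map_cat => /eqP; rewrite eqseq_cat ?size_map //.
  rewrite eqseq_cat ?size_map ?xm // => /and3P [/eqP e1 /eqP e2 /eqP e3].
  exists (map (map g) (t (h N + n.+1))); split.
  - exact: Qinv.
  - rewrite size_map; apply: leq_trans Nt; apply: leq_trans (leq_addr _ _).
    exact: increasing_ge.
  - rewrite -map_take size_rcons (take_nth [::]).
      rewrite te map_rcons -/(x (h N)) e2; congr rcons.
      by rewrite -[RHS]map_id; apply/eq_in_map => a sa; rewrite -[RHS]map_id;
        apply/eq_in_map => y ya; apply: (map_fix e1); apply/flattenP; exists a.
    by apply: leq_trans Nt; rewrite leq_addl.
have /choice [nx hnx] : forall s, exists x, ext s -> ext (rcons s x).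
  move=> s; case: (pselect (ext s)) => [/step [x hx]|n]; first by exists x.
  by exists [::].
pose fix ls k := if k is k'.+1 then rcons (ls k') (nx (ls k')) else [::].
have exts k : ext (ls k).
  elim: k => [|k IHk] /=; last exact: hnx.
  by move=> N; have [t Qt Nt] := Qlong N; exists t; rewrite take0.
exists (fun k => nx (ls k)) => n.
suff -> : mkseq (fun k => nx (ls k)) n = ls n.
  by have [t [Qt _ <-]] := exts n 0; apply: Qtake.
by elim: n => // n IHn; rewrite mkseqS IHn.
Qed.

(** Compactness makes the bound in S1 uniform, which is needed because half
    graphs are only available in finite length. *)
Lemma S1_bound (W : M -> seq M -> Prop) (r : seq M) m :
  (forall g x a, G g -> map g r = r -> W x a -> W (g x) (map g a)) ->
  exists N, forall t : seq (seq M), size t = N ->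
    (forall a, a \in t -> size a = m /\ infinite_set [set x | W x a]) ->
    exists i j x, [/\ i < j, j < N, W x (nth [::] t i) & W x (nth [::] t j)].
Proof.
move=> Winv; apply: contrapT => /forallNP noN.
pose Q (t : seq (seq M)) := (forall a, a \in t -> size a = m /\ infinite_set [set x | W x a]) /\
  forall i j x, i < j -> j < size t -> W x (nth [::] t i) -> ~ W x (nth [::] t j).
have [||||b hb] := @konig Q m r.
- move=> g t Gg gr [Q1 Q2]; have [h Gh [gK hK]] := G_inv Gg.
  have hr : map h r = r by rewrite -{1}gr -map_comp (eq_map gK) map_id.
  split.
    move=> _ /mapP [a /Q1 [sa infa] ->]; rewrite size_map; split=> // fin; apply: infa.
    apply: sub_finite_set (finite_image h fin) => x Wx; exists (g x) => //.
    exact: Winv.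
  move=> i j x ij; rewrite size_map => jt.
  have it := ltn_trans ij jt.
  rewrite !(nth_map [::]) // => Wi Wj.
  have WK a : W x (map g a) -> W (h x) a.
    by move=> /(Winv _ _ _ Gh hr); rewrite -map_comp (eq_map gK) map_id.
  exact: Q2 ij jt (WK _ Wi) (WK _ Wj).
- move=> t k [Q1 Q2]; split=> [a /mem_take/Q1//|i j x ij].
  rewrite size_take_min leq_min => /andP [jk jt].
  by rewrite !nth_take ?(ltn_trans ij jk) //; apply: Q2.
- by move=> t a [Q1 _] /Q1 [].
- move=> N; have /existsNP [t] := noN N.
  move=> /not_implyP [st] /not_implyP [Q1 Q2]; exists t; last by rewrite st.
  split=> // i j x ij jt Wi Wj; apply: Q2; exists i, j, x; split=> //.
  by rewrite -st.
have hbn n : size (b n) = m /\ infinite_set [set x | W x (b n)].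
  by have [Q1 _] := hb n.+1; apply: Q1; apply: (map_f b); rewrite mem_iota ltnS leqnn.
have [||s sinj [x hx]] := @S1_params W r m b 2 Winv.
- by move=> i; have [] := hbn i.
- by move=> i; have [] := hbn i.
have ne : s ord0 <> s (lift ord0 ord0) by move=> /sinj.
have main i j : i < j -> W x (b i) -> ~ W x (b j).
  move=> ij; have [_ /(_ i j x ij)] := hb j.+1.
  by rewrite size_mkseq !nth_mkseq // ?ltnS ?(ltnW ij) //; apply.
case: (ltngtP (s ord0) (s (lift ord0 ord0))) => // lt; exact: main lt _ _.
Qed.

(** * The finest congruence of finite index *)

Definition finite_congruence (E : M -> M -> Prop) : Prop :=
  [/\ forall x, E x x, forall x y, E x y -> E y x,
      forall x y z, E x y -> E y z -> E x z,
      forall g x y, G g -> E x y -> E (g x) (g y) & fin_index E].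

Definition finest (x y : M) : Prop := forall E, finite_congruence E -> E x y.

Lemma finest_refl x : finest x x. Proof. by move=> E []. Qed.
Lemma finest_sym x y : finest x y -> finest y x.
Proof. by move=> h E gE; have := h E gE; case: gE => _ + _ _ _; apply. Qed.
Lemma finest_trans x y z : finest x y -> finest y z -> finest x z.
Proof.
move=> h h' E gE; have := h E gE; have := h' E gE; case: gE => _ _ t _ _ yz xy.
exact: t xy yz.
Qed.
Lemma finest_inv g x y : G g -> finest x y -> finest (g x) (g y).
Proof. by move=> Gg h E gE; have := h E gE; case: gE => _ _ _ + _; apply. Qed.

(** There are finitely many orbits of pairs, and for each orbit outside [finest]
    a single congruence excludes it. *)
Lemma finest_index : fin_index finest.
Proof.
have [p [f hf]] := G_oligo 2.
have /choice [E hE] : forall c : 'I_p, exists E : M -> M -> Prop,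
    finite_congruence E /\ ((exists u v, f [:: u; v] = c /\ ~ finest u v) ->
      exists u v, f [:: u; v] = c /\ ~ E u v).
  move=> c; case: (pselect (exists u v, f [:: u; v] = c /\ ~ finest u v)).
    move=> [u [v [fc /existsNP [E /not_implyP [gE nE]]]]].
    by exists E; split=> // _; exists u, v.
  move=> n; exists (fun _ _ => True); split=> //; split=> //.
  by exists 1, (fun=> ord0).
have [q [c hc]] : fin_index (fun x y => forall i, E i x y).
  by apply: fin_index_all => i; have [[_ _ _ _]] := hE i.
exists q, c => x y /hc Exy; apply: contrapT => nxy.
have [[_ _ _ Einv _]] := hE (f [:: x; y]).
case; first by exists x, y.
move=> u [v [fuv]]; apply.
have [|||g Gg [<- <-]] := hf [:: x; y] [:: u; v] => //.
exact: Einv.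
Qed.

(** These permutations play the part of the automorphisms that fix the imaginary
    algebraic closure of the empty set. *)
Definition G0 (g : M -> M) : Prop := G g /\ forall x, finest x (g x).

Lemma G0_id : G0 id.
Proof. by split=> // x; apply: finest_refl. Qed.

Lemma G0_comp g h : G0 g -> G0 h -> G0 (g \o h).
Proof.
move=> [Gg eg] [Gh eh]; split; first exact: G_comp.
by move=> x; apply: finest_trans (eh x) (eg _).
Qed.

Lemma G0_inv g : G0 g -> exists2 h, G0 h & cancel g h /\ cancel h g.
Proof.
move=> [Gg eg]; have [h Gh [gK hK]] := G_inv Gg; exists h => //; split=> // x.
by apply: finest_sym; have := eg (h x); rewrite hK.
Qed.

Lemma G0_normal g h k : G g -> cancel h g -> G h -> G0 k -> G0 (g \o k \o h).
Proof.
move=> Gg hK Gh [Gk ek]; split; first by do 2!apply: G_comp => //.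
by move=> x /=; have := finest_inv Gg (ek (h x)); rewrite hK.
Qed.

(** [G] permutes the classes, so fixing a point of a class fixes the class. *)
Lemma G0_reps : exists r : seq M, forall g, G g -> map g r = r -> G0 g.
Proof.
have [r hr] := fin_index_reps finest_index.
exists r => g Gg gr; split=> // x; have [y yr xy] := hr x.
apply: (finest_trans xy); apply: finest_sym.
by rewrite -(map_fix gr yr); apply: (finest_inv Gg xy).
Qed.

Lemma G0_oligo n : exists p (f : seq M -> 'I_p), forall a b,
  size a = n -> size b = n -> f a = f b -> exists2 g, G0 g & map g a = b.
Proof.
have [r hr] := G0_reps; have [p [f hf]] := G_oligo (n + size r).
exists p, (fun a => f (a ++ r)) => a b sa sb e.
have [|||g Gg] := hf (a ++ r) (b ++ r); rewrite ?size_cat ?sa ?sb //.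
rewrite map_cat => /eqP; rewrite eqseq_cat ?size_map ?sa //.
by move=> /andP [/eqP e1 /eqP /hr]; exists g => //; auto.
Qed.

(** Lying in the same [G0]-orbit is itself a congruence of finite index, as [G0]
    is normal and, by [G0_reps], oligomorphic. *)
Lemma finest_orbit x y : finest x y -> exists2 g, G0 g & g x = y.
Proof.
move=> /(_ (fun x y => exists2 g, G0 g & g x = y)); apply; split.
- by move=> {}x; exists id => //; apply: G0_id.
- move=> {}x {}y [g Gg <-]; have [h Gh [gK _]] := G0_inv Gg.
  by exists h.
- move=> {}x {}y z [g Gg <-] [h Gh <-]; exists (h \o g) => //; exact: G0_comp.
- move=> g {}x {}y Gg [k Gk <-]; have [h Gh [gK hK]] := G_inv Gg.
  exists (g \o k \o h); first exact: G0_normal.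
  by rewrite /= gK.
- have [p [f hf]] := G0_oligo 1; exists p, (fun z => f [:: z]) => {}x {}y e.
  by have [|||g Gg [<-]] := hf [:: x] [:: y] => //; exists g.
Qed.

(** Equality on the finite set [A0], with one more class for its complement, is a
    congruence of finite index. *)
Lemma finest_A0 x y : finest x y -> A0 x -> x = y.
Proof.
suff h : finite_congruence (fun x y => x = y \/ (~ A0 x /\ ~ A0 y)).
  by move=> /(_ _ h) [//|[]].
split.
- by left.
- by move=> ? ? [->|[]]; [left|right].
- by move=> u v w [->//|[nu nv]] [<-|[]]; right.
- move=> g u v Gg [->|[nu nv]]; first by left.
  have [h Gh [gK hK]] := G_inv Gg.
  by right; split=> /(A0_inv Gh); rewrite gK.
have /finite_seqP [s es] := A0_fin.
apply: (@fin_indexF _ 'I_(size s).+1 (fun z => inord (index z s))) => u v.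
move=> /(congr1 val); rewrite /= !inordK ?ltnS ?index_size // => e.
case: (pselect (A0 u)) => Au.
  left; have us : u \in s by move: Au; rewrite es.
  by rewrite -(nth_index u us) e nth_index // -index_mem -e index_mem.
right; split=> // Av; have vs : v \in s by move: Av; rewrite es.
by apply: Au; rewrite es /= -index_mem e index_mem.
Qed.

(** [G_acl] is applied with representatives of all classes added to [b], since
    their stabilizer is contained in [G0]. For the conclusion not to mention them,
    they must avoid [Y] or lie in [A0]; this is possible because a class contained
    in [Y] is finite and the union of the finite classes is contained in [A0]. *)
Lemma G0_acl (Y : set M) (b : seq M) : finite_set Y ->
  (forall g, G0 g -> map g b = b -> forall y, Y y -> Y (g y)) ->
  forall y, Y y -> y \in b \/ A0 y.
Proof.
move=> finY Yinv y Yy.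
have finC : finite_set [set z | finite_set [set u | finest z u]].
  have [p [f hf]] := finest_index.
  pose Z c := [set z | f z = c /\ finite_set [set u | finest z u]].
  rewrite (_ : mkset _ = \bigcup_(c in [set: 'I_p]) Z c); last first.
    by apply/seteqP; split=> [z hz|z [c _ []]//]; exists (f z).
  apply: bigcup_finite => // c _.
  case: (pselect (exists z, Z c z)) => [[z [fz finz]]|n]; last first.
    suff -> : Z c = set0 by []; apply/seteqP; split=> // z hz; by apply: n; exists z.
  by apply: sub_finite_set finz => w [fw _]; apply: hf; rewrite fz.
have CA z : finite_set [set u | finest z u] -> A0 z.
  move=> finz; case: (G_acl (b := [::]) finC _ finz) => // g Gg _ w /= finw.
  have [h Gh [gK hK]] := G_inv Gg.
  apply: sub_finite_set (finite_image g finw) => u gwu; exists (h u); last exact: hK.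
  by have := finest_inv Gh gwu; rewrite gK.
have /choice [rep hrep] : forall x, exists x', finest x x' /\ (A0 x' \/ ~ Y x').
  move=> x; apply: contrapT => /forallNP n.
  suff Ax : A0 x by apply: (n x); split; [apply: finest_refl|left].
  apply: CA; apply: sub_finite_set finY => u xu; apply: contrapT => nY.
  by apply: (n u); split=> //; right.
have [r hr] := fin_index_reps finest_index.
have inv g : G g -> map g (b ++ map rep r) = b ++ map rep r ->
    forall u, Y u -> Y (g u).
  move=> Gg; rewrite map_cat => /eqP; rewrite eqseq_cat ?size_map //.
  move=> /andP [/eqP gb /eqP gr]; apply: Yinv => //; split=> // x.
  have [z zr xz] := hr x; have [zrz _] := hrep z.
  have xrz := finest_trans xz zrz.
  apply: (finest_trans xrz); apply: finest_sym.
  rewrite -(map_fix gr (map_f rep zr)); exact: (finest_inv Gg xrz).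
case: (G_acl finY inv Yy); last by right.
rewrite mem_cat => /orP [yb|/mapP [z zr e]]; first by left.
by right; have [_ []] := hrep z; rewrite -e.
Qed.

(** [lab x y] names the [G0]-orbit of [(x, y)] by a colour chosen among those that
    occur in it. *)
Lemma pair_labels : exists p (lab : M -> M -> 'I_p), forall x y x' y',
  lab x y = lab x' y' <-> exists2 g, G0 g & g x = x' /\ g y = y'.
Proof.
have [p [f hf]] := G0_oligo 2.
pose orb x y u v := exists2 g, G0 g & g x = u /\ g y = v.
have orb_refl x y : orb x y x y by exists id; [apply: G0_id|].
have orb_sym x y u v : orb x y u v -> orb u v x y.
  by move=> [g Gg [<- <-]]; have [h Gh [gK _]] := G0_inv Gg; exists h.
have orb_trans x y u v u' v' : orb x y u v -> orb u v u' v' -> orb x y u' v'.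
  move=> [g Gg [<- <-]] [h Gh [<- <-]]; exists (h \o g) => //; exact: G0_comp.
pose P x y c := `[< exists u v, orb x y u v /\ f [:: u; v] = c >].
pose lab x y : option 'I_p := [pick c | P x y c].
have lab_orb x y x' y' : lab x y = lab x' y' <-> orb x y x' y'.
  split=> [|o].
    rewrite /lab; case: pickP => [c|noP]; last first.
      by have /asboolPn := negbT (noP (f [:: x; y])); case; exists x, y.
    move=> /asboolP [u [v [puv <-]]].
    case: pickP => // c' /asboolP [u' [v' [puv2 <- ]]] [e].
    apply: (orb_trans _ _ _ _ _ _ puv); apply: (orb_trans _ _ u' v'); last exact: orb_sym.
    by have [|||g Gg [e1 e2]] := hf [:: u; v] [:: u'; v'] => //; exists g.
  rewrite /lab; apply: eq_pick => c; apply/asboolP/asboolP => -[u [v [puv fc]]];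
    exists u, v; split=> //; apply: orb_trans puv => //; exact: orb_sym.
exists #|{: option 'I_p}|, (fun x y => enum_rank (lab x y)) => x y x' y'.
by rewrite -/(orb x y x' y') -lab_orb; split=> [/enum_rank_inj|->].
Qed.

Section Labels.
Variables (L : finType) (lab : M -> M -> L).
Hypothesis labP : forall x y x' y',
  lab x y = lab x' y' <-> exists2 g, G0 g & g x = x' /\ g y = y'.

Lemma lab_G0 g x y : G0 g -> lab (g x) (g y) = lab x y.
Proof. by move=> Gg; apply/esym/labP; exists g. Qed.

Lemma lab_inv g x y x' y' : G g ->
  lab x y = lab x' y' -> lab (g x) (g y) = lab (g x') (g y').
Proof.
move=> Gg /labP [k Gk [<- <-]]; have [h Gh [gK hK]] := G_inv Gg.
apply/labP; exists (g \o k \o h); first exact: G0_normal.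
by rewrite /= !gK.
Qed.

Lemma lab_finest x y x' y' : lab x y = lab x' y' -> finest x x' /\ finest y y'.
Proof. by move=> /labP [k [_ Gk] [<- <-]]. Qed.

Lemma lab_eq x y x' y' : lab x y = lab x' y' -> (x = y <-> x' = y').
Proof.
move=> /labP [k Gk [<- <-]]; have [h _ [gK _]] := G0_inv Gk.
by split=> [->//|]; apply: (can_inj gK).
Qed.

Definition plab (q : M * M) : L := lab q.1 q.2.
Definition pmap2 (g : M -> M) (q : M * M) : M * M := (g q.1, g q.2).

(** [x] is a generic realization of the labels [z] over [a] and [p] over [b];
    labels are given by pairs of points so that [G] acts on them. *)
Definition realizes (z : seq (M * M)) (p : M * M) (a : seq M) (b x : M) : Prop :=
  [/\ ~ A0 x, x \notin a, x <> b, map (lab x) a = map plab z & lab x b = plab p].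

Definition amalg z p a b : Prop := exists x, realizes z p a b x.

Lemma realizes_inv g z p a b x : G g -> realizes z p a b x ->
  realizes (map (pmap2 g) z) (pmap2 g p) (map g a) (g b) (g x).
Proof.
move=> Gg [h1 h2 h3 h4 h5]; have [h Gh [gK hK]] := G_inv Gg; split.
- by move=> /(A0_inv Gh); rewrite gK.
- by rewrite (mem_map (can_inj gK)).
- by move=> /(can_inj gK).
- elim: a z h4 {h2} => [|y a IHa] [|q z] //= [e1 e2].
  by rewrite (IHa _ e2) (lab_inv Gg e1).
- exact: (lab_inv Gg h5).
Qed.

Lemma realizes_lab z p z' p' a b x : map plab z = map plab z' -> plab p = plab p' ->
  realizes z p a b x -> realizes z' p' a b x.
Proof. by move=> e e' [h1 h2 h3 h4 h5]; split=> //; rewrite -?e -?e'. Qed.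

Lemma pmap2_G0 g z : G0 g -> map plab (map (pmap2 g) z) = map plab z.
Proof. by move=> Gg; rewrite -map_comp; apply: eq_map => q; apply: lab_G0. Qed.

Lemma realizes_G0 g z p a b x : G0 g -> realizes z p a b x ->
  realizes z p (map g a) (g b) (g x).
Proof.
move=> Gg h; apply: realizes_lab (realizes_inv (proj1 Gg) h).
  exact: pmap2_G0.
exact: lab_G0.
Qed.

Lemma pmap2K g h : cancel g h -> cancel (pmap2 g) (pmap2 h).
Proof. by move=> gK [x y]; rewrite /pmap2 /= !gK. Qed.

Lemma amalg_inv g z p a b : G g ->
  amalg (map (pmap2 g) z) (pmap2 g p) (map g a) (g b) <-> amalg z p a b.
Proof.
move=> Gg; have [h Gh [gK hK]] := G_inv Gg.
split=> -[x hx]; last by exists (g x); apply: realizes_inv.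
exists (h x); have := realizes_inv Gh hx.
by rewrite (mapK (pmap2K gK)) (pmap2K gK) (mapK gK) gK.
Qed.

Lemma amalg_G0 g z p a b : G0 g -> amalg z p (map g a) (g b) <-> amalg z p a b.
Proof.
move=> Gg; have [h Gh [gK hK]] := G0_inv Gg.
split=> -[x hx]; last by exists (g x); apply: realizes_G0.
by exists (h x); have := realizes_G0 Gh hx; rewrite (mapK gK) gK.
Qed.

(** By triviality: a realization outside [a], [b] and [A0] is not algebraic. *)
Lemma realizes_infinite z p a b x : realizes z p a b x ->
  infinite_set [set y | realizes z p a b y].
Proof.
move=> hx fin; have [nA xa xb _ _] := hx.
case: (G0_acl (b := rcons a b) fin _ hx) => // [g Gg|].
  rewrite map_rcons => /rcons_inj [ea eb] y /(realizes_G0 Gg).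
  by rewrite ea eb.
by rewrite mem_rcons inE (negPf xa) orbF => /eqP.
Qed.

(** * Finiteness of the amalgamation relation *)

Definition sim z p (a a' : seq M) : Prop := forall b,
  ~ A0 b -> b \notin a -> b \notin a' -> amalg z p a b <-> amalg z p a' b.

(** The difference of [amalg z p a] and [amalg z p a'] is invariant over [a] and
    [a'], so that it lies in the exceptional set as soon as it is finite. *)
Lemma sim_finite z p a a' :
  finite_set [set b | ~ (amalg z p a b <-> amalg z p a' b)] <-> sim z p a a'.
Proof.
split=> [fin b nA ba ba'|h].
  apply: contrapT => nb.
  case: (G0_acl (b := a ++ a') fin _ nb) => // [g Gg|].
    rewrite map_cat => /eqP; rewrite eqseq_cat ?size_map // => /andP [/eqP ea /eqP ea'] y.
    by rewrite /= -(amalg_G0 z p a y Gg) -(amalg_G0 z p a' y Gg) ea ea'.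
  by rewrite mem_cat (negPf ba) (negPf ba').
apply: (sub_finite_set (B := A0 `|` [set` a ++ a'])).
  move=> b /= nb; apply: contrapT => /not_orP [nA] /=.
  by rewrite mem_cat => /negP; rewrite negb_or => /andP [ba ba']; apply/nb/h.
by rewrite finite_setU; split=> //; apply: finite_seq.
Qed.

Lemma sim_refl z p a : sim z p a a. Proof. by []. Qed.

Lemma sim_sym z p a a' : sim z p a a' -> sim z p a' a.
Proof. by move=> h b nA ba ba'; rewrite h. Qed.

Lemma sim_trans z p a a' a'' : sim z p a a' -> sim z p a' a'' -> sim z p a a''.
Proof.
move=> /sim_finite h /sim_finite h'; apply/sim_finite.
apply: (sub_finite_set (B := [set b | ~ (amalg z p a b <-> amalg z p a' b)] `|`
   [set b | ~ (amalg z p a' b <-> amalg z p a'' b)])).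
  move=> b /= n; apply: contrapT => /not_orP [/= /contrapT e /contrapT e'].
  by apply: n; rewrite e e'.
by rewrite finite_setU; split.
Qed.

Lemma sim_inv g z p a a' : G g -> sim z p a a' ->
  sim (map (pmap2 g) z) (pmap2 g p) (map g a) (map g a').
Proof.
move=> Gg s b nA ba ba'; have [h Gh [gK hK]] := G_inv Gg.
rewrite -[b]hK !amalg_inv //; apply: s.
- by move=> /(A0_inv Gg); rewrite hK.
- by rewrite -(mem_map (can_inj gK)) hK.
- by rewrite -(mem_map (can_inj gK)) hK.
Qed.

(** A common realization of the labels over [(al i, b i)] and [(al j, b j)], for
    [i < j], would witness [amalg z p (al i) (b j)]. So a half graph provides
    pairwise disjoint infinite sets, whose number is bounded by [S1_bound]. *)
Lemma no_half_graph z p n : exists N, forall (al : nat -> seq M) (b : nat -> M),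
  (forall i, size (al i) = n) ->
  ~ (forall i j, i < N -> j < N -> i <= j ->
       (amalg z p (al i) (b j) <-> i = j)).
Proof.
have [r hr] := G0_reps.
pose W x c := exists a b, c = rcons a b /\ realizes z p a b x.
have Winv g x c : G g -> map g r = r -> W x c -> W (g x) (map g c).
  move=> Gg gr [a [b [-> h]]]; exists (map g a), (g b).
  rewrite map_rcons; split=> //; apply: realizes_G0 => //; exact: hr.
have [N hN] := S1_bound n.+1 Winv.
exists N => al b sal H.
have WE x i : W x (rcons (al i) (b i)) -> realizes z p (al i) (b i) x.
  by move=> [a [c [/rcons_inj [-> ->]]]].
have [||i [j [x [ij jN]]]] := hN (mkseq (fun i => rcons (al i) (b i)) N).
- by rewrite size_mkseq.
- move=> c /mapP [i]; rewrite mem_iota /= => iN ->; rewrite size_rcons sal; split=> //.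
  have [x hx] : amalg z p (al i) (b i) by apply/H.
  move=> fin; apply: (realizes_infinite hx); apply: sub_finite_set fin => y hy.
  by exists (al i), (b i).
have iN := ltn_trans ij jN.
rewrite !nth_mkseq // => /WE [A1 A2 A3 A4 A5] /WE [B1 B2 B3 B4 B5].
have : amalg z p (al i) (b j) by exists x.
by rewrite H ?(ltnW ij) // => e; move: ij; rewrite e ltnn.
Qed.

(** An infinite sequence [al] of inequivalent tuples is thinned out so that the
    differences of [amalg z p (al i)] and [amalg z p (al j)], for [i < j], are
    infinite in a constant direction, and so that its [N]-tuples are conjugate.
    S1 for these differences gives a point [b0] such that, for [N] values of [i],
    [amalg z p] relates it to the tuple of index [T i] and not to that of index
    [F i]. By homogeneity, any increasing choice among these [T i] and [F i] can
    be moved to an initial segment of the sequence, which takes [b0] to the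
    vertices of a half graph. *)
Lemma sim_fin_index z p n : exists q (f : seq M -> 'I_q), forall a a',
  size a = n -> size a' = n -> f a = f a' -> sim z p a a'.
Proof.
have [//|[al sal nsim]] := @infinite_antichain (seq M) (fun a => size a = n)
  (sim z p) (@sim_refl z p) (@sim_sym z p) (@sim_trans z p).
exfalso.
pose D a a' := [set b | amalg z p a b /\ ~ amalg z p a' b].
have [N noHG] := no_half_graph z p n.
(* The differences are infinite in one constant direction. *)
have [h1 inc1 [c hc]] := ramsey 2 (fun s =>
  `[< infinite_set (D (al (nth 0 s 0)) (al (nth 0 s 1))) >]).
pose T i := if c then i.*2 else i.*2.+1.
pose F i := if c then i.*2.+1 else i.*2.
have DTF (h : nat -> nat) : increasing h ->
    forall i, infinite_set (D (al (h1 (h (T i)))) (al (h1 (h (F i))))).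
  move=> inch i fin.
  have := hc [:: h i.*2; h i.*2.+1]; rewrite /= inch // => /(_ erefl erefl).
  move: fin; rewrite /T /F; case: c {hc T F} => fin; first by move/asboolP.
  move=> /asboolPn /contrapT fin'.
  have lt : h1 (h i.*2) < h1 (h i.*2.+1) by apply: inc1; apply: inch.
  apply: (nsim _ _ lt); apply/sim_finite.
  apply: sub_finite_set (_ : finite_set (D _ _ `|` D _ _)); last first.
    by rewrite finite_setU; split; [exact: fin|exact: fin'].
  move=> b nb; apply: contrapT => /not_orP [n1 n2]; apply: nb; split=> hb.
    by apply: contrapT => nb'; apply: n2; split.
  by apply: contrapT => nb'; apply: n1; split.
(* An N-tuple carries one side of a half graph of the forbidden length. *)
have [q [f hf]] := G0_oligo (N * n).
have [h2 inc2 [c2 hcol2]] := ramsey N (fun s => f (flatten (map (al \o h1) s))).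
pose be i := al (h1 (h2 i)).
have sbe i : size (be i) = n by apply: sal.
have shape_be (s : seq nat) : shape (map be s) = nseq (size s) n.
  by elim: s => //= i s ->; rewrite sbe.
have size_be (s : seq nat) : size s = N -> size (flatten (map be s)) = (N * n)%N.
  by move=> e; rewrite size_flatten shape_be sumn_nseq e mulnC.
have homog (s : seq nat) : size s = N -> sorted ltn s ->
    exists2 g, G0 g & forall i, i < N -> map g (be (nth 0 s i)) = be i.
  move=> e so; have [|||g Gg eg] := hf (flatten (map be s)) (flatten (map be (iota 0 N))).
  - exact: size_be.
  - by apply: size_be; rewrite size_iota.
  - have he u : flatten (map be u) = flatten (map (al \o h1) (map h2 u)).
      by rewrite -map_comp.
    rewrite !he !hcol2 ?size_map ?size_iota //.
    exact: iota_ltn_sorted.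
  exists g => // i iN; move: eg; rewrite map_flatten => /eq_from_flatten_shape ess.
  have {}ess : map (map g) (map be s) = map be (iota 0 N).
    apply: ess; rewrite shape_be size_iota -e -shape_be /shape -map_comp.
    by apply: eq_map => a /=; rewrite size_map.
  have := congr1 (nth [::] ^~ i) ess.
  by rewrite /= -map_comp (nth_map 0) ?e // (nth_map 0) ?size_iota // nth_iota.
(* Consistency of the differences yields an alternating element b0. *)
have [r hr] := G0_reps.
pose W b c := exists a1 a2, [/\ c = a1 ++ a2, size a1 = n, amalg z p a1 b &
  ~ amalg z p a2 b].
have [|||s sinj [b0 hb0]] := @S1_params W r (n + n) (fun i => be (T i) ++ be (F i)) N.
- move=> g b a Gg /(hr _ Gg) G0g [a1 [a2 [-> sa1 h h']]].
  exists (map g a1), (map g a2); rewrite size_map map_cat; split=> //.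
    exact/amalg_G0.
  by rewrite amalg_G0.
- by move=> i; rewrite size_cat !sbe.
- move=> i fin; apply: (DTF h2 inc2 i); apply: sub_finite_set fin => b [hb hb'].
  by exists (be (T i)), (be (F i)).
have {}hb0 i : i \in codom s -> amalg z p (be (T i)) b0 /\ ~ amalg z p (be (F i)) b0.
  move=> /codomP [k ->]; have [a1 [a2 [/eqP + sa1 ha1 ha2]]] := hb0 k.
  by rewrite eqseq_cat ?sbe // => /andP [/eqP -> /eqP ->].
pose t := sort leq (codom s).
have st : size t = N by rewrite size_sort size_codom card_ord.
have tin i : i < N -> nth 0 t i \in codom s.
  by move=> iN; rewrite -(mem_sort leq) mem_nth // -/t st.
have tso : sorted ltn t.
  rewrite ltn_sorted_uniq_leq sort_uniq (sort_sorted leq_total) andbT.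
  by rewrite map_inj_uniq ?enum_uniq.
have tlt i i' : i < i' -> i' < N -> nth 0 t i < nth 0 t i'.
  move=> ii' iN; apply: (sorted_ltn_nth ltn_trans 0 tso) => //; rewrite inE st //.
  exact: ltn_trans iN.
pose v j i := if i < j then F (nth 0 t i) else T (nth 0 t i).
have vlt j i i' : i < i' -> i' < N -> v j i < v j i'.
  move=> ii' iN; have lt := tlt _ _ ii' iN.
  have hi k : F k <= k.*2.+1 /\ T k <= k.*2.+1 by rewrite /F /T; case: c {hc T F DTF hb0 v homog W}.
  have lo k : k.*2 <= F k /\ k.*2 <= T k by rewrite /F /T; case: c {hc T F DTF hb0 v homog W hi}.
  have h1' : v j i <= (nth 0 t i).*2.+1 by rewrite /v; case: ifP => _; case: (hi (nth 0 t i)).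
  have h2' : (nth 0 t i').*2 <= v j i' by rewrite /v; case: ifP => _; case: (lo (nth 0 t i')).
  apply: leq_ltn_trans h1' _; apply: leq_trans h2'.
  by rewrite -doubleS leq_double.
have /choice [b hb] : forall j, exists b, forall i, i < N ->
    (amalg z p (be i) b <-> j <= i).
  move=> j; have [||g Gg hg] := homog (mkseq (v j) N); first by rewrite size_mkseq.
    rewrite /mkseq sorted_map.
    apply: (sub_in_sorted (P := fun i => i < N) (e := ltn)); last exact: iota_ltn_sorted.
      by move=> i i' iN i'N ii'; apply: vlt.
    by apply/allP => i; rewrite mem_iota.
  exists (g b0) => i iN; rewrite -(hg i iN) nth_mkseq // amalg_G0 // /v.
  by have [h h'] := hb0 _ (tin i iN); case: leqP => _; split.
apply: (noHG be b sbe) => i j iN jN ij; rewrite hb //; split=> [ji|->//].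
by apply/eqP; rewrite eqn_leq ij.
Qed.

(** Quantifying over all [z], [p] and [a1] makes this relation [G]-invariant. *)
Definition same_amalgams n (b b' : M) : Prop := forall z p a1, size a1 = n -> size z = n ->
  (exists a, [/\ size a = n, sim z p a a1, b \notin a & amalg z p a b]) <->
  (exists a, [/\ size a = n, sim z p a a1, b' \notin a & amalg z p a b']).

(** Finite index: there are finitely many labels, and for fixed labels finitely
    many [sim]-classes of [a1], by [sim_fin_index]. *)
Lemma same_amalgams_congruence n : finite_congruence (same_amalgams n).
Proof.
have trans g z p a1 b : G g ->
    (exists a, [/\ size a = n, sim z p a a1, b \notin a & amalg z p a b]) ->
    exists a, [/\ size a = n, sim (map (pmap2 g) z) (pmap2 g p) a (map g a1),
       g b \notin a & amalg (map (pmap2 g) z) (pmap2 g p) a (g b)].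
  move=> Gg [a [sa s ba h]]; exists (map g a); have [k Gk [gK kK]] := G_inv Gg.
  rewrite size_map; split=> //; first exact: sim_inv.
    by rewrite (mem_map (can_inj gK)).
  exact/amalg_inv.
split.
- by [].
- by move=> b b' h z p a1 sa sz; rewrite h.
- by move=> b b' b'' h h' z p a1 sa sz; rewrite h // h'.
- move=> g b b' Gg h z p a1 sa sz; have [k Gk [gK kK]] := G_inv Gg.
  have half u v : same_amalgams n u v ->
    (exists a, [/\ size a = n, sim z p a a1, g u \notin a & amalg z p a (g u)]) ->
    (exists a, [/\ size a = n, sim z p a a1, g v \notin a & amalg z p a (g v)]).
    move=> huv /(trans k _ _ _ _ Gk); rewrite gK.
    have /huv H : size (map k a1) = n by rewrite size_map.
    move=> /H; rewrite size_map => /(_ sz) /(trans g _ _ _ _ Gg).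
    by rewrite !(mapK (pmap2K kK)) (pmap2K kK) (mapK kK).
  split; apply: half => // z' p' a' sa' sz'.
  by rewrite h.
- pose E (i : n.-tuple L * L) b b' := forall z p a1, size a1 = n -> size z = n ->
    map plab z = i.1 -> plab p = i.2 ->
    (exists a, [/\ size a = n, sim z p a a1, b \notin a & amalg z p a b]) <->
    (exists a, [/\ size a = n, sim z p a a1, b' \notin a & amalg z p a b']).
  suff [q [f hf]] : fin_index (fun b b' => forall i, E i b b').
    exists q, f => b b' /hf h z p a1 sa sz.
    have szl : size (map plab z) == n by rewrite size_map sz.
    exact: (h (Tuple szl, plab p)).
  apply: fin_index_all => -[l k].
  case: (pselect (exists z p, [/\ size z = n, map plab z = l & plab p = k])); last first.
    move=> no; exists 1, (fun=> ord0) => b b' _ z p a1 sa sz ez ep.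
    by case: no; exists z, p.
  move=> [z0 [p0 [sz0 ez0 ep0]]].
  have [q [f hf]] := sim_fin_index z0 p0 n.
  pose S a1 b := exists a, [/\ size a = n, sim z0 p0 a a1, b \notin a & amalg z0 p0 a b].
  pose bit b (c : 'I_q) := `[< exists a1, [/\ size a1 = n, f a1 = c & S a1 b] >].
  apply: (@fin_indexF _ {ffun 'I_q -> bool} (fun b => [ffun c => bit b c])) => b b' e.
  have {}e c : bit b c = bit b' c by have := congr1 (fun h : {ffun _} => h c) e; rewrite !ffunE.
  have {e} SS a1 : size a1 = n -> S a1 b <-> S a1 b'.
    move=> sa; have half u u' : bit u (f a1) = bit u' (f a1) -> S a1 u -> S a1 u'.
      move=> eb Su; have : bit u (f a1) by apply/asboolP; exists a1.
      rewrite eb => /asboolP [a2 [sa2 fa2 [a [sa' s ua h]]]]; exists a; split=> //.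
      by apply: sim_trans s _; apply: hf.
    by split; apply: half.
  move=> z p a1 sa sz ez ep.
  have amE a u : amalg z p a u <-> amalg z0 p0 a u.
    split=> -[x hx]; exists x; apply: realizes_lab hx; by rewrite ?ez0 ?ep0.
  have simE a a' : sim z p a a' <-> sim z0 p0 a a'.
    by split=> s u h1 h2 h3; have := s u h1 h2 h3; rewrite !amE.
  have := SS a1 sa; rewrite /S => -[H1 H2].
  by split=> -[a [h1 /simE h2 h3 /amE h4]];
    [have [|a' [g1 /simE g2 g3 /amE g4]] := H1 _|have [|a' [g1 /simE g2 g3 /amE g4]] := H2 _];
    by [exists a|exists a'].
Qed.

(** The independence theorem. To pass from [a] to [b :: a], let [x] realize the
    labels over [a] and let [b1] be such that [(x, b1)] has the label prescribed
    for [b]. Moving [b1] over [x] out of [a] makes [amalg] true at a point of the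
    class of [b], and [same_amalgams_congruence] transfers this to [b]. *)
Theorem amalgamation (a : seq M) (t : M -> M * M) (x0 : M) :
  uniq a -> (forall y, y \in a -> ~ A0 y) -> ~ A0 x0 ->
  (forall y, y \in a ->
     [/\ (t y).1 <> (t y).2, finest x0 (t y).1 & finest y (t y).2]) ->
  exists x, [/\ ~ A0 x, x \notin a, finest x0 x &
    forall y, y \in a -> lab x y = plab (t y)].
Proof.
elim: a => [|b a IHa] /= ua nA nx0 ht.
  by exists x0; split=> //; apply: finest_refl.
move: ua => /andP [ba ua].
have nAb : ~ A0 b by apply: nA; rewrite inE eqxx.
have [||y ya|x [nx xa x0x hx]] := IHa ua.
- by move=> y ya; apply: nA; rewrite inE ya orbT.
- by [].
- by apply: ht; rewrite inE ya orbT.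
have [neq x0d be] : [/\ (t b).1 <> (t b).2, finest x0 (t b).1 & finest b (t b).2].
  by apply: ht; rewrite inE eqxx.
have /finest_orbit [g Gg gx] := finest_trans (finest_sym x0d) x0x.
pose b1 := g (t b).2.
have bb1 : finest b b1 := finest_trans be (proj2 Gg _).
have xb1 : x <> b1.
  by have [h _ [gK _]] := G0_inv Gg; rewrite /b1 -gx => /(can_inj gK).
have nAb1 : ~ A0 b1.
  move=> A; have e := finest_A0 (finest_sym bb1) A.
  by apply: nAb; rewrite -e.
(* Move b1 over x away from a. *)
have [k [Gk kx ka kA]] : exists k, [/\ G0 k, k x = x, k b1 \notin a & ~ A0 (k b1)].
  apply: contrapT => no.
  pose O := [set y | exists2 k, G0 k & k x = x /\ k b1 = y].
  have finO : finite_set O.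
    apply: (sub_finite_set (B := [set` a])); last exact: finite_seq.
    move=> _ [k Gk [kx <-]] /=; apply: contrapT => /negP ka; apply: no.
    exists k; split=> // A; apply: nAb1; have [h [Gh _] [kK _]] := G0_inv Gk.
    by rewrite -(kK b1); apply: A0_inv.
  case: (G0_acl (b := [:: x]) finO _ (y := b1)) => //.
  - move=> h Gh [hx1] _ [k Gk [kx <-]]; exists (h \o k); first exact: G0_comp.
    by rewrite /= kx.
  - by exists id; [apply: G0_id|].
  - by rewrite inE => /eqP /esym.
have bb2 : finest b (k b1) := finest_trans bb1 (proj2 Gk _).
have am : amalg (map t a) (t b) a (k b1).
  exists x; split=> //.
  - by move=> e; apply: xb1; have [h _ [kK _]] := G0_inv Gk; apply: (can_inj kK); rewrite kx.
  - by rewrite -map_comp; apply/eq_in_map => y ya; rewrite hx.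
  - apply/esym/labP; exists (k \o g); first exact: G0_comp.
    by rewrite /= gx kx.
have /(_ _ (same_amalgams_congruence (size a)) (map t a) (t b) a erefl) := finest_sym bb2.
rewrite size_map => /(_ erefl) [+ _] => -[].
  by exists a; split=> //; apply: sim_refl.
move=> a' [sa' ss ba' /(proj1 (ss b nAb ba' ba))].
move=> [y [nAy ya yb hy1 hy2]]; exists y; split=> //.
- by rewrite inE negb_or ya andbT; apply/eqP.
- by have [e _] := lab_finest hy2; apply: finest_trans x0d (finest_sym e).
move=> u; rewrite inE => /orP [/eqP ->//|ua'].
by move: hy1; rewrite -map_comp => /eq_in_map /(_ u ua').
Qed.

(** * Finite approximations *)

Lemma lab_swap x y x' y' : lab x y = lab x' y' -> lab y x = lab y' x'.
Proof. by move=> /labP [g Gg [<- <-]]; rewrite lab_G0. Qed.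

Lemma lab_A0 a x x' : A0 a -> finest x x' -> lab a x = lab a x'.
Proof.
move=> Aa /finest_orbit [g Gg <-]; apply/labP; exists g => //; split=> //.
by rewrite -(finest_A0 (proj2 Gg a) Aa).
Qed.

Lemma lab_diag x x' : finest x x' -> lab x x = lab x' x'.
Proof. by move=> /finest_orbit [g Gg <-]; rewrite lab_G0. Qed.

Lemma finest_other x : ~ A0 x -> exists2 y, x <> y & finest x y.
Proof.
move=> nA; apply: contrapT => no; apply: nA.
have inv g : G0 g -> map g [::] = [::] -> forall y, [set x] y -> [set x] (g y).
  move=> Gg _ y ->; apply: contrapT => ne; apply: no; exists (g x).
    by move=> e; apply: ne.
  exact: (proj2 Gg).
by case: (G0_acl (finite_set1 x) inv (erefl x)).
Qed.

Section FiniteStructure.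
Variables (U : eqType) (rho : U -> U -> L).

(** The positions of a back-and-forth game between M and a finite labelled
    structure. *)
Definition coherent (Z : seq (M * U)) : Prop :=
  forall p1 p2, p1 \in Z -> p2 \in Z -> lab p1.1 p2.1 = rho p1.2 p2.2.

End FiniteStructure.

(** The vertices are the points of [A0] and [m] copies of each of finitely many
    points [c] that represent the other classes; they are labelled through pairs
    [P u v] of points of M. Extensions from M to [U] come from
    [generic_extension], and extensions from [U] to M from [amalgamation]. *)
Theorem finite_approximation (q : nat) (x0 : M) :
  exists (U : finType) (rho : U -> U -> L),
  [/\ forall u v x y, rho u v = lab x y -> (u = v <-> x = y),
      forall Z x, size Z <= q -> coherent rho Z ->
        exists y, coherent rho ((x, y) :: Z) &
      forall Z y, coherent rho Z -> exists x, coherent rho ((x, y) :: Z)].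
Proof.
have /finite_seqP [s es] := A0_fin.
have As a : a \in s <-> A0 a by rewrite es.
have [r hr] := fin_index_reps finest_index.
pose Cs := [seq y <- r | ~~ `[< A0 y >]].
pose C := seq_sub Cs.
have CA (c : C) : ~ A0 (val c).
  by have := valP c; rewrite mem_filter => /andP [/asboolPn].
have toC x : ~ A0 x -> exists c : C, finest x (val c).
  move=> nA; have [y yr xy] := hr x.
  have yC : y \in Cs.
    rewrite mem_filter yr andbT; apply/asboolPn => Ay.
    by apply: nA; rewrite -(finest_A0 (finest_sym xy) Ay).
  by exists (SeqSub yC).
(* Pairs of points realizing a label l between two classes, if there are any. *)
have /choice [pk hpk] : forall t : C * C * L, exists d : M * M,
    [/\ d.1 <> d.2, finest (val t.1.1) d.1, finest (val t.1.2) d.2 &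
      (exists d' : M * M, [/\ d'.1 <> d'.2, finest (val t.1.1) d'.1,
         finest (val t.1.2) d'.2 & plab d' = t.2]) -> plab d = t.2].
  move=> [[c c'] l] /=.
  case: (pselect (exists d' : M * M, [/\ d'.1 <> d'.2, finest (val c) d'.1,
         finest (val c') d'.2 & plab d' = l])) => [[d [h1 h2 h3 h4]]|no].
    by exists d.
  have [y ny cy] : exists2 y, val c <> y & finest (val c') y.
    case: (pselect (val c = val c')) => [->|ne]; first exact: finest_other.
    by exists (val c') => //; apply: finest_refl.
  by exists (val c, y); split=> //; apply: finest_refl.
have [m [f hf]] := generic_extension C (lab x0 x0) q.
pose W := (C * 'I_m)%type.
pose U := (seq_sub s + W)%type.
pose col (u : U) : M := match u with inl a => val a | inr w => val w.1 end.
pose swap (d : M * M) := (d.2, d.1).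
pose P0 (u v : W) : M * M := if prec u v then pk (u.1, v.1, f (edge u v))
  else swap (pk (v.1, u.1, f (edge u v))).
pose P (u v : U) : M * M := if u == v then (col u, col v) else
  match u, v with inr u', inr v' => P0 u' v' | _, _ => (col u, col v) end.
have precN (u v : W) : u != v -> prec v u = ~~ prec u v.
  move=> uv; rewrite /prec; case: (ltngtP (enum_rank v) (enum_rank u)) => //.
  by move=> /ord_inj/enum_rank_inj e; rewrite e eqxx in uv.
have P_swap u v : P v u = swap (P u v).
  rewrite /P eq_sym; case: eqP => // /eqP; case: u v => [a|u] [b|v] //= uv.
  have {}uv : u != v by apply: contraNneq uv => ->.
  have e : edge v u = edge u v by rewrite /edge precN //; case: (prec u v).
  rewrite /P0 e precN //; case: (prec u v) => //=; by case: (pk _).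
have P_fin u v : finest (col u) (P u v).1 /\ finest (col v) (P u v).2.
  have base x y : finest x (x, y).1 /\ finest y (x, y).2 by split; apply: finest_refl.
  rewrite /P; case: eqP => // _; case: u v => [a|u] [b|v]; try exact: base.
  rewrite /P0 /=.
  by case: (prec u v); [have [_ h1 h2 _] := hpk (u.1, v.1, f (edge u v))|
    have [_ h1 h2 _] := hpk (v.1, u.1, f (edge u v))]; split.
have P_neq u v : u != v -> (P u v).1 <> (P u v).2.
  move=> uv; rewrite /P (negPf uv); move: uv; case: u v => [a|u] [b|v] //= uv.
  - by move=> /val_inj e; rewrite e eqxx in uv.
  - move=> e; apply: (CA v.1); apply: (eq_ind (val a) A0 _ _ e).
    by apply/As; apply: valP.
  - move=> e; apply: (CA u.1); apply: (eq_ind (val b) A0 _ _ (esym e)).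
    by apply/As; apply: valP.
  - by rewrite /P0; case: (prec u v); [have [h1 _ _ _] := hpk (u.1, v.1, f (edge u v))|
    have [h1 _ _ _] := hpk (v.1, u.1, f (edge u v))] => //= /esym.
have P_diag u : P u u = (col u, col u) by rewrite /P eqxx.
pose rho u v := plab (P u v).
have rho_eq u v x y : rho u v = lab x y -> (u = v <-> x = y).
  move=> /lab_eq <-; split=> [->|]; first by rewrite P_diag.
  by move=> e; apply/eqP; apply: contraT => /P_neq.
have coh_col Z p : coherent rho Z -> p \in Z -> finest p.1 (col p.2).
  by move=> cZ pZ; have := cZ p p pZ pZ; rewrite /rho P_diag => /lab_finest [].
have coh_fun Z p1 p2 : coherent rho Z -> p1 \in Z -> p2 \in Z ->
    p1.1 = p2.1 <-> p1.2 = p2.2.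
  by move=> cZ h1 h2; have /esym/rho_eq -> := cZ p1 p2 h1 h2.
have coh_cons Z x y : coherent rho Z -> finest x (col y) ->
    (forall p, p \in Z -> lab x p.1 = rho y p.2) -> coherent rho ((x, y) :: Z).
  move=> cZ xy h p1 p2; rewrite !inE => /orP [/eqP ->|h1] /orP [/eqP ->|h2] /=.
  - by rewrite /rho P_diag; apply: lab_diag.
  - exact: h.
  - by rewrite /rho P_swap; apply: lab_swap; apply: h.
  - exact: cZ.
have coh_dup Z p : coherent rho Z -> p \in Z -> coherent rho (p :: Z).
  move=> cZ pZ p1 p2; rewrite !inE => h1 h2; apply: cZ.
    by case/orP: h1 => [/eqP ->|].
  by case/orP: h2 => [/eqP ->|].
have coh_A0 Z a (aS : A0 a) y : coherent rho Z -> col y = a -> coherent rho ((a, y) :: Z).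
  move=> cZ ya; apply: coh_cons => //; first by rewrite ya; apply: finest_refl.
  move=> p pZ; have pc := coh_col Z p cZ pZ.
  rewrite (lab_A0 aS pc) /rho /P ya.
  case: eqP => [<-|_]; first by rewrite ya.
  case: y ya => [b|y] /= ya; last first.
    by case: (CA y.1); apply: (eq_ind a A0 aS _ (esym ya)).
  by case: (p.2).
have mem_part (T1 T2 : eqType) (Z : seq (T1 * T2)) a : a \in unzip1 Z -> exists u, (a, u) \in Z.
  by move=> /mapP [[b u] h /= ->]; exists u.
exists U, rho; split=> //.
  move=> Z x sZ cZ.
  case: (boolP (x \in unzip1 Z)) => [/mem_part [u xu]|xZ].
    by exists u; apply: coh_dup.
  case: (pselect (A0 x)) => Ax.
    have xs : x \in s by apply/As.
    by exists (inl (SeqSub xs)); apply: coh_A0.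
  have [c xc] := toC x Ax.
  pose w := pmap (fun p : M * U => if p.2 is inr w then Some w else None) Z.
  have wP w' : w' \in w <-> exists a, (a, inr w') \in Z.
    rewrite mem_pmap; split=> [/mapP [[a [b|u]] h //= [->]]|[a h]]; first by exists a.
    by apply/mapP; exists (a, inr w').
  have /choice [pt hpt] : forall w', exists a, w' \in w -> (a, inr w') \in Z.
    move=> w'; case: (boolP (w' \in w)) => [/wP [a h]|]; first by exists a.
    by exists x.
  have sw : size w <= q by rewrite size_pmap; apply: leq_trans (count_size _ _) sZ.
  have [j jw hj] := hf w c (fun w' => lab x (pt w')) (fun w' => lab (pt w') x) sw.
  exists (inr (c, j)); apply: coh_cons => // -[a [b|u]] auZ /=.
    have ab : a = val b.
      apply/esym; apply: finest_A0; last by apply/As; apply: valP.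
      by apply: finest_sym; apply: (coh_col Z (a, inl b) cZ auZ).
    rewrite /rho /P /= ab; apply: lab_swap; apply: lab_A0 => //.
    by apply/As; apply: valP.
  have uw : u \in w by apply/wP; exists a.
  have ptu : pt u = a.
    by have /(_ erefl) := proj2 (coh_fun Z (pt u, inr u) (a, inr u) cZ (hpt u uw) auZ).
  have xa : x <> a by move=> e; move: xZ; rewrite e (map_f fst auZ).
  have au : finest (val u.1) a by apply: finest_sym; apply: (coh_col Z (a, inr u) cZ auZ).
  have cu : (inr (c, j) == inr u :> U) = false.
    by apply/negP => /eqP [e]; move: jw; rewrite e uw.
  have := hj u uw; rewrite /rho /P cu /P0 ptu.
  case: ifP => pr ->.
    have [_ _ _ /= e] := hpk (c, u.1, lab x a); apply/esym; apply: e.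
    by exists (x, a); split=> //; apply: finest_sym.
  have [_ _ _ /= e] := hpk (u.1, c, lab a x); apply/esym.
  have {}e : plab (pk (u.1, c, lab a x)) = lab a x.
    apply: e; exists (a, x); split=> //; first by move=> /= /esym.
    exact: finest_sym.
  exact: lab_swap e.
move=> Z y cZ.
have [/mapP [[a u] auZ /= ->]|yZ] := boolP (y \in unzip2 Z).
  by exists a; apply: coh_dup.
case ey : y => [b|w]; rewrite -ey.
  by exists (val b); apply: coh_A0 => //; [apply/As; apply: valP|rewrite ey].
pose a := undup [seq a <- unzip1 Z | ~~ `[< A0 a >]].
have aP x : x \in a -> ~ A0 x /\ exists u, (x, u) \in Z.
  by rewrite mem_undup mem_filter => /andP [/asboolPn nA /mem_part].
have /choice [pt hpt] : forall x, exists u, x \in a -> (x, u) \in Z.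
  move=> x; case: (boolP (x \in a)) => [/aP [_ [u h]]|]; first by exists u.
  by exists y.
have [|||x xa|x [nx xa yx hx]] := @amalgamation a (fun x => P y (pt x)) (col y).
- exact: undup_uniq.
- by move=> x /aP [].
- by rewrite ey; apply: CA.
- have xu := hpt x xa; split.
  + apply: P_neq; apply: contraNneq yZ => ->; exact: (map_f snd xu).
  + by have [] := P_fin y (pt x).
  + by apply: finest_trans (coh_col Z _ cZ xu) _; have [] := P_fin y (pt x).
exists x; apply: coh_cons => //; first exact: finest_sym.
move=> [d u] duZ /=; case: (pselect (A0 d)) => Ad.
  have du := finest_A0 (coh_col Z (d, u) cZ duZ) Ad.
  have [b eb] : exists b, u = inl b.
    case: u du {duZ} => [b|u'] /= du; first by exists b.
    by case: (CA u'.1); apply: (eq_ind d A0 Ad _ du).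
  rewrite /rho /P ey eb /= -[val b]/(col (inl b)) -eb -du.
  apply: lab_swap; apply: lab_A0 => //; apply: finest_sym.
  by rewrite ey in yx.
have da : d \in a by rewrite mem_undup mem_filter (map_f fst duZ) andbT; apply/asboolPn.
rewrite hx //; congr plab; congr P.
by have /(_ erefl) := proj1 (coh_fun Z (d, pt d) (d, u) cZ (hpt d da) duZ).
Qed.

End Labels.

End PermutationGroup.

(** * Pseudofiniteness *)

Fixpoint depth V n (phi : formula V n) : nat :=
  match phi with
  | Imp p q => maxn (depth p) (depth q)
  | All p => (depth p).+1
  | _ => 0
  end.

Section BackAndForth.
Local Open Scope nat_scope.
Variables (V : vocabulary) (hV : binary V) (M : structure V).
Let Mc : choiceType := {classic M}.
Variables (L : finType) (lab : Mc -> Mc -> L).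
Hypothesis labP : forall x y x' y' : M, lab x y = lab x' y' ->
  exists2 g, isomorphism (M := M) (N := M) g & g x = x' /\ g y = y'.
Variables (q : nat) (U : finType) (rho : U -> U -> L) (u0 : U).
Hypothesis rho_eq : forall u v x y, rho u v = lab x y -> (u = v <-> x = y).
Hypothesis forth : forall Z x, size Z <= q -> coherent lab rho Z ->
  exists y, coherent lab rho ((x, y) :: Z).
Hypothesis back : forall Z y, coherent lab rho Z ->
  exists x, coherent lab rho ((x, y) :: Z).

Definition same_labels n (v : n.-tuple M) (w : n.-tuple U) : Prop :=
  forall i j, lab (tnth v i) (tnth v j) = rho (tnth w i) (tnth w j).

(** Relations are read off tuples of M with the same labels; in arity at most 2
    the choice of the tuple does not matter, by [labels_aut]. *)
Definition labelled_structure : structure V :=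
  @Structure V U (fun r t => exists2 t' : (arity r).-tuple M,
    same_labels t' t & interp t') (inhabits u0).

Lemma labels_aut k (t t' : k.-tuple M) : k <= 2 ->
  (forall i j, lab (tnth t i) (tnth t j) = lab (tnth t' i) (tnth t' j)) ->
  exists2 g, isomorphism (M := M) (N := M) g & map_tuple g t = t'.
Proof.
case: k t t' => [|[|[|//]]] t t' _ h.
- by exists id; [apply: aut_id|apply: val_inj; rewrite /= (tuple0 t) (tuple0 t')].
- have [g ag [e _]] := labP (h ord0 ord0); exists g => //.
  by apply: eq_from_tnth => i; rewrite tnth_map ord1.
- have [g ag [e e']] := labP (h ord0 (lift ord0 ord0)); exists g => //.
  apply: eq_from_tnth => i; rewrite tnth_map.
  by case: (unliftP ord0 i) => [j ->|->] //; rewrite ord1.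
Qed.

Lemma coherent_zip n (v : n.-tuple M) (w : n.-tuple U) :
  same_labels v w <-> coherent lab rho (zip (v : seq Mc) w).
Proof.
have sz : size (zip (v : seq Mc) w) = n by rewrite size_zip !size_tuple minnn.
have nz x0 i : nth x0 (zip (v : seq Mc) w) i = (nth x0.1 v i, nth x0.2 w i).
  by case: x0 => a b; rewrite nth_zip // !size_tuple.
split=> h.
  move=> p1 p2 /(nthP p1) [i + <-] /(nthP p1) [j + <-].
  rewrite sz !nz /= => lti ltj.
  have := h (Ordinal lti) (Ordinal ltj).
  by rewrite !(tnth_nth p1.1) !(tnth_nth p1.2).
move=> i j; set x0 : Mc * U := (tnth v i, tnth w i).
have := h (nth x0 (zip (v : seq Mc) w) i) (nth x0 (zip (v : seq Mc) w) j).
rewrite !mem_nth ?sz // => /(_ erefl erefl).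
by rewrite !nz /= -!(tnth_nth x0.1) -!(tnth_nth x0.2).
Qed.

Lemma sat_labelled n (phi : formula V n) (v : n.-tuple M)
    (w : n.-tuple labelled_structure) :
  n + depth phi <= q.+1 -> same_labels v w -> sat phi v <-> sat phi w.
Proof.
elim: phi v w => {n} [n|n i j|n r t|n p IHp p' IHp'|n p IHp] v w //= dq vw.
- exact: iff_sym (rho_eq (esym (vw i j))).
- split=> [h|[t' st ht]].
    by exists (map_tuple (tnth v) t) => // a b; rewrite !tnth_map; apply: vw.
  have [||g ag e] := @labels_aut (arity r) t' (map_tuple (tnth v) t).
  + exact: hV.
  + by move=> a b; rewrite st !tnth_map vw.
  by rewrite -e; apply: (proj1 (proj2 ag r t') ht).
- have dp : n + depth p <= q.+1 by apply: leq_trans dq; rewrite leq_add2l leq_maxl.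
  have dp' : n + depth p' <= q.+1 by apply: leq_trans dq; rewrite leq_add2l leq_maxr.
  by rewrite (IHp v w) // (IHp' v w).
- rewrite addnS in dq.
  have cz := proj1 (coherent_zip v w) vw.
  have step x y : coherent lab rho ((x, y) :: zip (v : seq Mc) w) ->
      sat p [tuple of x :: v] <-> sat p [tuple of y :: w].
    move=> c; apply: IHp; first by rewrite addSn.
    exact/coherent_zip.
  split=> h.
    by move=> y; have [x /step <-] := back y cz; apply: h.
  have nq : size (zip (v : seq Mc) w) <= q.
    rewrite size_zip !size_tuple minnn; apply: leq_trans (leq_addr _ _) _; exact: dq.
  by move=> x; have [y /step ->] := forth x nq cz; apply: h.
Qed.

End BackAndForth.

Theorem pseudofinite (V : vocabulary) (T : set (sentence V)) (M : structure V) (q : nat) :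
  binary V -> omega_categorical T -> SU_rank T 1 -> trivial_pregeometry T ->
  model T M -> countably_infinite M ->
  exists2 N : structure V, finite_structure N &
    forall phi : sentence V, (depth phi <= q)%N -> holds N phi <-> holds M phi.
Proof.
move=> hV hcat hSU htriv modM ctM.
pose Mc : choiceType := {classic M}.
pose G : (Mc -> Mc) -> Prop := isomorphism (M := M) (N := M).
have Gid : G id := aut_id M.
have Gcomp (g h : Mc -> Mc) : G g -> G h -> G (g \o h) := @aut_comp V M g h.
have Ginv (g : Mc -> Mc) : G g -> exists2 h, G h & cancel g h /\ cancel h g.
  exact: aut_inv.
have Gol := oligomorphic hcat modM ctM.
have InE (y : Mc) s : List.In y s -> y \in s.
  by elim: s => //= z s IHs [->|/IHs h]; rewrite inE ?eqxx // h orbT.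
have Gacl (Y : set Mc) (b : seq Mc) : finite_set Y ->
    (forall g, G g -> map g b = b -> forall y, Y y -> Y (g y)) ->
    forall y, Y y -> y \in b \/ acl (M := M) set0 y.
  move=> fY Yi y Yy.
  by case: (acl_finite_orbits hcat modM ctM htriv fY Yi Yy) => [/InE|]; [left|right].
have hSU' (a : 1.-tuple M) : ~ SU_ge 2 set0 a by apply: (proj1 hSU).
have GS1 := consistent_along_orbit hcat modM ctM htriv hSU'.
have A0f : finite_set (acl (M := M) set0 : set Mc) := acl0_finite hcat modM ctM.
have A0i (g : Mc -> Mc) x : G g -> acl (M := M) set0 x -> acl (M := M) set0 (g x).
  exact: acl0_inv.
have [p [lab labP]] := @pair_labels Mc G Gid Gcomp Ginv Gol.
have [x0] : inhabited M by apply: carrier_inhabited.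
have [U [rho [rho_eq forth back]]] :=
  @finite_approximation Mc G _ Gid Gcomp Ginv Gol Gacl A0f A0i GS1 _ lab labP q x0.
have [u0 _] := forth [::] x0 isT (fun _ _ h => ltac:(by [])).
have labA (x y x' y' : M) : lab x y = lab x' y' ->
   exists2 g, isomorphism (M := M) (N := M) g & g x = x' /\ g y = y'.
  by move=> /labP [g [Gg _] h]; exists g.
exists (labelled_structure (M := M) lab rho u0); first exact: finite_finset.
move=> phi dphi; apply: iff_sym.
apply: (@sat_labelled V hV M _ lab labA q U rho u0 rho_eq forth back 0%N phi
  [tuple of [::]] [tuple of [::]]).
  by rewrite add0n (leq_trans dphi).
by case.
Qed.

(** * Almost sure theories *)

Section AlmostSure.
Import Order.TTheory GRing.Theory Num.Theory numFieldNormedType.Exports.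
Local Open Scope classical_set_scope.
Local Open Scope ring_scope.

Lemma almost_sure_singletons (R : realType) (V : vocabulary)
    (N : nat -> structure V) (phi : sentence V) :
  almost_sure (R := R) (fun n => eq (N n))
    (fun n A => if `[< A (N n) >] then 1 else 0) phi <->
  exists n0, forall n, (n0 <= n)%N -> holds (N n) phi.
Proof.
rewrite /almost_sure; set u := (fun n : nat => _).
have uE n : u n = if `[< holds (N n) phi >] then 1 else 0.
  by rewrite /u; congr (if _ then _ else _); apply/asboolP/asboolP => [[]|].
split=> [|[n0 h]].
  move=> /cvgrPdist_lt /(_ 1 ltr01) [n0 _ h]; exists n0 => n nn.
  have := h n nn; rewrite /= uE; case: asboolP => //= _.
  by rewrite subr0 normr1 ltxx.
apply: cvg_near_cst; exists n0 => // n /h hn.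
by rewrite /= uE; case: asboolP.
Qed.

Lemma dirac_probability (R : realType) (U : Type) (x : U) :
  probability_on (R := R) (eq x) (fun A => if `[< A x >] then 1 else 0).
Proof.
split=> [A _|A B _ _ AB|]; first by case: asboolP => _; rewrite ?ler01.
  rewrite asbool_or; have := AB x.
  case: (asboolP (A x)) => hA; case: (asboolP (B x)) => hB //= nAB.
  - by case: nAB.
  - by rewrite addr0.
  - by rewrite add0r.
  - by rewrite addr0.
by case: asboolP.
Qed.

End AlmostSure.

Theorem theorem1p2 (R : realType) (V : vocabulary) (T : set (sentence V))
    (hV : binary V) (hcat : omega_categorical T) (hsimple : simple T)
    (hSU : SU_rank T 1) (htriv : trivial_pregeometry T) :
  exists (K : nat -> structure V -> Prop)
      (mu : nat -> (structure V -> Prop) -> R),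
    finite_structure_probabilities K mu /\
    almost_sure_theory K mu = deductive_closure T.
Proof.
have [_ [M modM ctM] _] := hcat.
have /choice [N hN] q : exists N, finite_structure N /\
    forall phi : sentence V, (depth phi <= q)%N -> holds N phi <-> holds M phi.
  by have [N fN hN] := pseudofinite q hV hcat hSU htriv modM ctM; exists N.
have [en en_surj] := sentence_enum V.
(* The n-th structure agrees with M on the first n sentences. *)
pose d n := \max_(i < n) depth (en i).
exists (fun n => eq (N (d n))), (fun n A => if `[< A (N (d n)) >] then 1%R else 0%R).
split.
  move=> n; split.
  - by exists (N (d n)).
  - by exists 1, (fun=> N (d n)) => x <-; exists ord0.
  - by move=> _ <-; have [] := hN (d n).
  - exact: dirac_probability.
have agree phi : exists n0, forall n, (n0 <= n)%N -> holds (N (d n)) phi <-> holds M phi.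
  have [i <-] := en_surj phi; exists i.+1 => n lt.
  by have [_] := hN (d n); apply; apply: (leq_bigmax (Ordinal lt)).
apply/seteqP; split=> phi; rewrite /almost_sure_theory /deductive_closure /=.
  move=> /(almost_sure_singletons R (fun n => N (d n))) [n0 h0] M' modM'.
  have [n1 h1] := agree phi; rewrite (complete_theory hcat modM ctM _ modM').
  by apply/(h1 (maxn n0 n1)); [apply: leq_maxr|apply: h0; apply: leq_maxl].
move=> /(_ M modM) hM; apply/(almost_sure_singletons R (fun n => N (d n))).
by have [n1 h1] := agree phi; exists n1 => n nn; apply/h1.
Qed.
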